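(* Let $G$ be a Lie group with Lie algebra $\mathfrak g$ and let $k\ge 1$. Identify $J^kG$ with $G\times\mathfrak g^k$ via the right trivialization. Then the multiplication law in $J^kG$ is $$(g,x_1,\dots,x_k)(h,y_1,\dots,y_k)=(gh,z_1,\dots,z_k),$$ where for each $1\le n\le k$ the element $z_n\in\mathfrak g$ is given by $$z_n=x_n+\sum_{\lambda\in\mathcal P_n}\operatorname{ad}_{x_{i_{\ell-1}}}\cdots\operatorname{ad}_{x_{i_1}}\operatorname{Ad}_g y_{i_\ell} = x_n+\sum_{\ell=1}^n\ \sum_{i_1+\dots+i_\ell=n}N_{(i_1,\dots,i_\ell)}\operatorname{ad}_{x_{i_{\ell-1}}}\cdots\operatorname{ad}_{x_{i_1}}\operatorname{Ad}_g y_{i_\ell},$$ and the inverse in $J^kG$ is $(g,x_1,\dots,x_k)^{-1}=(g^{-1},w_1,\dots,w_k)$, where for each $1\le n\le k$ the element $w_n\in\mathfrak g$ is given by $$w_n=\sum_{\lambda\in\mathcal P_n}(-1)^\ell\operatorname{Ad}_{g^{-1}}\operatorname{ad}_{x_{i_1}}\cdots\operatorname{ad}_{x_{i_{\ell-1}}}x_{i_\ell} =\sum_{\ell=1}^n\ \sum_{i_1+\dots+i_\ell=n}(-1)^\ell N_{(i_1,\dots,i_\ell)}\operatorname{Ad}_{g^{-1}}\operatorname{ad}_{x_{i_1}}\cdots\operatorname{ad}_{x_{i_{\ell-1}}}x_{i_\ell}.$$ Here, in the sums over $\lambda=\lambda_1|\dots|\lambda_\ell\in\mathcal P_n$, $\ell$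 is the length of $\lambda$ and $i_r=|\lambda_r|$; in the other sums, $(i_1,\dots,i_\ell)$ ranges over $\ell$-tuples of positive integers with sum $n$.
   Context: Jet group: $J^kG$ is the manifold of $k$-jets $j^kc$ at $0$ of smooth curves $c$ in $G$ (defined near $0\in\mathbb R$). It is a Lie group under $(j^kc)(j^kb):=j^k(cb)$, where $cb$ is the pointwise product; this does not depend on the representing curves. Right trivialization: for a smooth curve $c$ in $G$, the right logarithmic derivative is the curve $\delta^rc=c'c^{-1}$ in $\mathfrak g$. The right trivialization is the bundle isomorphism $J^kG\to G\times\mathfrak g^k$, $$j^kc\mapsto\left(c(0),(\delta^rc)(0),(\delta^rc)'(0),\dots,(\delta^rc)^{(k-1)}(0)\right).$$ (Its inverse sends $(g,x_1,\dots,x_k)$ to the $k$-jet of the curve $c$ with $c(0)=g$ and $\delta^rc(t)=x'(t)$, where $x(t)=tx_1+\frac{t^2}{2!}x_2+\dots+\frac{t^k}{k!}x_k$.) $\operatorname{Ad}$ is the adjoint action of $G$ on $\mathfrak g$ and $\operatorname{ad}_xy=[x,y]$, with the usual bracket convention $\frac{d}{dt}\big|_{t=0}\operatorname{Ad}_{\exp(tx)}y=[x,y]$. Partitions: $\mathcal P_n$ is the set of all partitions $\lambda=\lambda_1|\dots|\lambda_\ell$ of $\{1,\dots,n\}$ into nonempty disjoint subsets, each partition being ordered anti-lexicographically: the ordering is done from right to left, always choosing the subset that contains the highest available number (equivalently $\max\lambda_1<\dots<\max\lambda_\ell=n$). For example $\mathcal P_3=\{1|2|3,\ 12|3,\ 2|13,\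 1|23,\ 123\}$. The number $\ell$ is the length of $\lambda$. For positive integers $i_1,\dots,i_\ell$, $$N_{(i_1,\dots,i_\ell)}=\binom{i_1+\dots+i_\ell-1}{i_\ell-1}\binom{i_1+\dots+i_{\ell-1}-1}{i_{\ell-1}-1}\cdots\binom{i_1+i_2-1}{i_2-1},$$ which equals $1$ (empty product) when $\ell=1$. Empty products of $\operatorname{ad}$ operators are the identity. *)

(* Defs.v *)
From HB Require Import structures.
From mathcomp Require Import all_boot all_order all_algebra generic_quotient.
From mathcomp Require Import all_classical all_reals all_analysis.
Set Implicit Arguments.
Unset Strict Implicit.
Unset Printing Implicit Defensive.
Import Order.TTheory GRing.Theory Num.Theory.
Import numFieldNormedType.Exports.
Local Open Scope ring_scope.
Local Open Scope classical_set_scope.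
Local Open Scope quotient_scope.

Definition iter_derive {R : realType} {V W : normedModType R}
    (vs : seq V) (f : V -> W) : V -> W :=
  foldr (fun v (g : V -> W) x => 'D_v g x) f vs.

(* For open [U] in a finite-dimensional space (the only case used below), this
   says that [f] is C^oo on [U]. *)
Definition smooth_on {R : realType} {V W : normedModType R}
    (U : set V) (f : V -> W) : Prop :=
  forall (vs : seq V) (x : V), U x -> differentiable (iter_derive vs f) x.

Record chart (R : realType) (d : nat) (T : topologicalType) := Chart {
  chart_dom : set T;
  chart_fun :> T -> 'rV[R]_d;
  chart_inv : 'rV[R]_d -> T;
  chart_dom_open : open chart_dom;
  chart_img_open : open (chart_fun @` chart_dom);
  chartK : forall x, chart_dom x -> chart_inv (chart_fun x) = x;
  chart_continuous : {in chart_dom, continuous chart_fun};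
  chart_inv_continuous : {in chart_fun @` chart_dom, continuous chart_inv}
}.

(* A real Lie group of dimension [d].  The domains on which the coordinate
   expressions are required to be smooth are open, the transition maps and the
   group operations being continuous. *)
HB.mixin Record isLieGroup (R : realType) (d : nat) G
    of Group G & Topological G := {
  lie_atlas : set (chart R d G);
  lie_hausdorff : hausdorff_space G;
  lie_atlas_cover : forall x : G,
    exists2 phi, lie_atlas phi & chart_dom phi x;
  lie_atlas_compat : forall phi psi, lie_atlas phi -> lie_atlas psi ->
    smooth_on (phi @` (chart_dom phi `&` chart_dom psi))
      (fun u => psi (chart_inv phi u));
  lie_mul_continuous : continuous (fun p : G * G => (p.1 * p.2)%g);
  lie_inv_continuous : continuous (fun p : G => (p^-1)%g);
  lie_mul_smooth : forall phi psi chi,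
    lie_atlas phi -> lie_atlas psi -> lie_atlas chi ->
    smooth_on
      [set p : 'rV[R]_d * 'rV[R]_d |
        [/\ (phi @` chart_dom phi) p.1, (psi @` chart_dom psi) p.2 &
            chart_dom chi (chart_inv phi p.1 * chart_inv psi p.2)%g]]
      (fun p => chi (chart_inv phi p.1 * chart_inv psi p.2)%g);
  lie_inv_smooth : forall phi psi, lie_atlas phi -> lie_atlas psi ->
    smooth_on
      [set u | (phi @` chart_dom phi) u /\
               chart_dom psi (chart_inv phi u)^-1%g]
      (fun u => psi (chart_inv phi u)^-1%g)
}.

#[short(type="lieGroupType")]
HB.structure Definition LieGroup (R : realType) (d : nat) :=
  {G of Group G & Topological G & isLieGroup R d G}.

Section Jets.
Context {R : realType} {d : nat} {G : lieGroupType R d}.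

(* Curves defined near 0 are represented by total functions, whose values away
   from 0 play no role. *)
Definition smooth_near0 (c : R -> G) : Prop :=
  exists2 U : set R, open_nbhs 0 U &
    {in U, continuous c} /\
    forall phi : chart R d G, lie_atlas phi ->
      smooth_on (U `&` c @^-1` chart_dom phi) (phi \o c).

Record curve := Curve {
  curve_fun :> R -> G;
  curve_smooth : `[< smooth_near0 curve_fun >]
}.

HB.instance Definition _ := [isSub for curve_fun].
HB.instance Definition _ := [Choice of curve by <:].

Lemma iter_derive_cst (V W : normedModType R) (vs : seq V) (w : W) :
  exists w', iter_derive vs (cst w) = cst w'.
Proof.
elim: vs => [|v vs [w' IH]]; first by exists w.
exists 0; rewrite /= -/(iter_derive vs _) IH.
by apply/funext => x /=; rewrite derive_cst.
Qed.

Lemma smooth_near0_cst (g : G) : `[< smooth_near0 (fun=> g) >].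
Proof.
apply/asboolP; exists setT; first by split; [exact: openT|].
split=> [x _|phi _ vs x _]; first exact: cst_continuous.
have -> : phi \o (fun=> g) = cst (phi g) by [].
by have [w ->] := iter_derive_cst vs (phi g).
Qed.

Definition cst_curve (g : G) : curve := Curve (smooth_near0_cst g).

Definition jet_eq (k : nat) (c b : curve) : bool :=
  `[< c 0 = b 0 /\
      forall phi : chart R d G, lie_atlas phi -> chart_dom phi (c 0) ->
      forall i, (i <= k)%N ->
        derive1n i (phi \o c) 0 = derive1n i (phi \o b) 0 >].

Lemma jet_eq_refl k : reflexive (jet_eq k).
Proof. by move=> c; apply/asboolP. Qed.

Lemma jet_eq_sym k : symmetric (jet_eq k).
Proof.
move=> c b; apply/asboolP/asboolP => -[e0 e]; split=> // phi aphi dphi i ik;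
  by rewrite e// ?e0// -e0.
Qed.

Lemma jet_eq_trans k : transitive (jet_eq k).
Proof.
move=> b c a /asboolP[cb0 cb] /asboolP[ba0 ba]; apply/asboolP.
split; first by rewrite cb0.
by move=> phi aphi dphi i ik; rewrite cb// ba// -cb0.
Qed.

Canonical jet_equiv k :=
  EquivRel (jet_eq k) (@jet_eq_refl k) (@jet_eq_sym k) (@jet_eq_trans k).

Definition jet (k : nat) := {eq_quot jet_equiv k}.

HB.instance Definition _ k := EqQuotient.on (jet k).

(* The [k]-jet at 0 of [c]; a junk value if [c] is not smooth near 0,
   which does not occur in [jet_mul]: products of smooth curves are smooth. *)
Definition jet_of (k : nat) (c : R -> G) : jet k :=
  \pi_(jet k) (insubd (cst_curve 1%g) c).

Definition jet_mul (k : nat) (a b : jet k) : jet k :=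
  jet_of k (fun t => repr a t * repr b t)%g.

Definition jet_one (k : nat) : jet k := jet_of k (fun=> 1%g).

(* In the rest of this section, [phi] is a chart around the unit; the Lie
   algebra, i.e. the tangent space at the unit, is identified with R^d by means
   of this chart: the velocity at 0 of a curve [c] with [c 0 = 1] is the vector
   [derive1 (phi \o c) 0]. *)
Variable phi : chart R d G.

(* The differential at the unit of the conjugation by [g]. *)
Definition Ad (g : G) (y : 'rV[R]_d) : 'rV[R]_d :=
  'D_y (fun u => phi (g * chart_inv phi u * g^-1)%g) (phi 1%g).

(* [ad x y] is the bracket [x, y]: the derivative at t = 0 of [Ad (c t) y] for
   a curve [c] with [c 0 = 1] and velocity [x] at 0 (such as exp (t x)), here
   the one that is affine in the chart [phi]. *)
Definition ad (x y : 'rV[R]_d) : 'rV[R]_d :=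
  'D_x (fun u => Ad (chart_inv phi u) y) (phi 1%g).

(* The velocity c'(t) translated to the unit by right multiplication by
   c(t)^-1. *)
Definition right_log_derive (c : R -> G) (t : R) : 'rV[R]_d :=
  derive1 (fun s => phi (c s * (c t)^-1)%g) t.

Definition right_triv (k : nat) (a : jet k) : G * k.-tuple 'rV[R]_d :=
  (repr a 0, [tuple derive1n i (right_log_derive (repr a)) 0 | i < k]).

(* ad_{x_{i_(l-1)}} ... ad_{x_{i_1}} Ad_g y_{i_l} for s = (i_1, ..., i_l) *)
Definition mul_term (g : G) (x y : nat -> 'rV[R]_d) (s : seq nat) :
    'rV[R]_d :=
  foldl (fun v i => ad (x i) v) (Ad g (y (last 0%N s)))
    (take (size s).-1 s).

(* Ad_{g^-1} ad_{x_{i_1}} ... ad_{x_{i_(l-1)}} x_{i_l} *)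
Definition inv_term (g : G) (x : nat -> 'rV[R]_d) (s : seq nat) : 'rV[R]_d :=
  Ad g^-1%g (foldr (fun i v => ad (x i) v) (x (last 0%N s))
    (take (size s).-1 s)).

End Jets.

Arguments curve {R d} G.
Arguments jet {R d} G k.
Arguments jet_one {R d} G k.

(* The entries x_1, ..., x_k of a tuple, with the indices starting at 1. *)
Definition entry {R : realType} {d k : nat} (x : k.-tuple 'rV[R]_d) (i : nat) :
    'rV[R]_d :=
  nth 0 x i.-1.

(* The elements of [1, n] are represented by those of ['I_n], shifted by 1. *)
Definition is_partition (n : nat) (P : {set {set 'I_n}}) : bool :=
  finset.partition P [set: 'I_n]%SET.

(* The cardinals of the blocks, listed by increasing maximum of the blocks. *)
Definition block_sizes (n : nat) (P : {set {set 'I_n}}) : seq nat :=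
  [seq #|A| | A : {set 'I_n} <-
    sort (fun A B : {set 'I_n} => \max_(i in A) i <= \max_(i in B) i)%N
      (enum P)].

Definition is_composition (n : nat) (s : seq nat) : bool :=
  all (fun i => 0 < i)%N s && (sumn s == n).

(* With 0-based positions, the factor of index [r] involves i_(r+1). *)
Definition multN (s : seq nat) : nat :=
  (\prod_(1 <= r < size s)
     'C((sumn (take r.+1 s)).-1, (nth 0%N s r).-1))%N.

(* Main.v *)
(* For curves [c] and [b] in [G] and [v] in the Lie algebra, the right
   logarithmic derivative [delta] satisfies
     [delta (c b) = delta c + Ad_c (delta b)],
     [(Ad_c v)' = Ad_c v' + ad_(delta c) (Ad_c v)],
     [(Ad_(c^-1) v)' = Ad_(c^-1) (v' - ad_(delta c) v)],
   the last rule being obtained by differentiating [v = Ad_c (Ad_(c^-1) v)].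
   With the Leibniz rule, differentiating the term indexed by a partition of
   {1, ..., n} gives the terms indexed by the partitions obtained by adjoining an
   element below all the others, either as a new first block (derivative of [Ad])
   or in an existing block (derivative of an argument); each partition of a set
   with one more element arises exactly once.  The number of partitions with given
   block sizes follows by splitting off the last block, with Pascal's rule.

   For [c] with [c(0) = g], read as [u = phi (c g^-1)] in the chart at the unit,
   [delta c] is a smooth function of [(u, u')] and [u'] is a smooth function of
   [(u, delta c)].  Hence the k-jet of [c] and the pair formed by [c(0)] and the
   (k-1)-jet of [delta c] determine each other; all values of the latter are
   attained, since Picard iteration reaches a solution up to order k after
   finitely many steps, so that no differential equation has to be solved. *)
From HB Require Import structures.
Require Import Defs.
From mathcomp Require Import all_boot all_order all_algebra.
Set Implicit Arguments.
Unset Strict Implicit.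
Unset Printing Implicit Defensive.
Import Order.TTheory GRing.Theory Num.Theory.

(** * Compositions counted with multiplicity *)

(** Partitions and compositions are never compared directly: both sums are identified with a sum
    over the list [comps n], which repeats each composition as often as it occurs and grows by the
    same rule as the terms do under differentiation. Smoothness is given by iterated directional
    derivatives, and the chain rule produces a direction that varies with the point. Expanding that
    direction in finitely many continuous coordinates leaves derivatives in fixed directions. This
    one device yields the smoothness of composites, of [Ad] and of logarithmic derivatives, and the
    comparison of jets of composites. The Lie algebra is tied to the chart [phi] at the unit,
    whereas curves pass through arbitrary points: [c s] is therefore written as [c s * (c t)^-1]
    times [c t], and jets at [c 0] are read in a right translate of [phi]. A jet is a class with a
    chosen representative, so the formulas are proved for curves and transferred by [jet_eqE]: the
    right trivialization of a curve depends on its jet only, and determines it. *)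

(* The block sizes after adjoining to a set partition an element below all the
   others: it forms a new first block, or joins one of the blocks, whose order
   by maxima does not change. *)
Definition comp_step (s : seq nat) : seq (seq nat) :=
  (1%N :: s) :: [seq incr_nth s r | r <- iota 0 (size s)].

Fixpoint comps (n : nat) : seq (seq nat) :=
  if n is m.+1 then flatten [seq comp_step s | s <- comps m] else [:: [::]].

Lemma sumn_incr_nth s r : (r < size s)%N -> sumn (incr_nth s r) = (sumn s).+1.
Proof. by elim: s r => [//|a s IH] [|r] //= rs; rewrite IH// addnS. Qed.

Lemma comps_composition n s : s \in comps n -> is_composition n s.
Proof.
elim: n s => [|n IH] s /=; first by rewrite inE => /eqP ->.
move=> /flatten_mapP[t /IH/andP[tpos /eqP tn]].
rewrite inE => /predU1P[->|/mapP[r]].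
  by rewrite /is_composition /= tpos add1n tn eqxx.
rewrite mem_iota add0n => /andP[_ rt] ->.
rewrite /is_composition sumn_incr_nth// tn eqxx andbT.
apply/(all_nthP 0%N) => i; rewrite size_incr_nth rt => it.
by rewrite nth_incr_nth addn_gt0 (all_nthP 0%N tpos) ?orbT.
Qed.

Section SumComps.
Variable V : nmodType.
Local Open Scope ring_scope.
Implicit Types F : seq nat -> V.

(** This is the shape that the derivative of the term indexed by [s] must have; [derive1n_comps]
    takes it as a hypothesis. *)
Definition step_sum F (s : seq nat) : V := \sum_(t <- comp_step s) F t.

Lemma sum_compsS n F :
  \sum_(s <- comps n.+1) F s = \sum_(s <- comps n) step_sum F s.
Proof. by rewrite /= big_flatten /= big_map. Qed.

Lemma incr_nth_rcons s m r : (r < size s)%N ->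
  incr_nth (rcons s m) r = rcons (incr_nth s r) m.
Proof. by elim: s r => [//|a s IH] [|r] //= rs; rewrite IH. Qed.

Lemma incr_nth_rcons_last s m : incr_nth (rcons s m) (size s) = rcons s m.+1.
Proof. by elim: s => [//|a s IH] /=; rewrite IH. Qed.

(** A step on [rcons s m] either acts on [s] or increments [m]. Peeling from the right suits
    [mul_term], whose outermost bracket carries the last entry but one. *)
Lemma step_sum_rcons F s m :
  step_sum F (rcons s m) =
  step_sum (fun t => F (rcons t m)) s + F (rcons s m.+1).
Proof.
rewrite /step_sum /comp_step !big_cons !big_map size_rcons -addrA; congr (_ + _).
rewrite -addn1 iotaD big_cat /= add0n big_seq1 incr_nth_rcons_last; congr (_ + _).
rewrite !big_seq; apply: eq_bigr => r; rewrite mem_iota add0n => /andP[_ rs].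
by rewrite incr_nth_rcons.
Qed.

(** The last block contains the largest of [n.+1] elements, and the binomial coefficient chooses its
    [m] companions. In the induction the new lowest element either stays out of the last block or
    joins it: these are the two terms of Pascal's rule. *)
Lemma sum_comps_last n F : \sum_(s <- comps n.+1) F s =
  \sum_(m < n.+1) (\sum_(s <- comps (n - m)) F (rcons s m.+1)) *+ 'C(n, m).
Proof.
elim: n F => [|n IH] F.
  by rewrite big_ord1 /= !big_seq1.
rewrite sum_compsS IH.
transitivity (\sum_(m < n.+1)
    ((\sum_(s <- comps (n.+1 - m)) F (rcons s m.+1)) *+ 'C(n, m) +
     (\sum_(s <- comps (n - m)) F (rcons s m.+2)) *+ 'C(n, m))).
  apply: eq_bigr => m _; rewrite -mulrnDl; congr (_ *+ _).
  rewrite subSn; last by rewrite -ltnS.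
  rewrite sum_compsS -big_split; apply: eq_bigr => s _; exact: step_sum_rcons.
rewrite big_split /= [in RHS]big_ord_recl bin0 mulr1n subn0.
(* The first sum may be extended to [m = n.+1], where the binomial coefficient is 0. *)
transitivity (\sum_(m < n.+2)
    (\sum_(s <- comps (n.+1 - m)) F (rcons s m.+1)) *+ 'C(n, m) +
  \sum_(m < n.+1) (\sum_(s <- comps (n - m)) F (rcons s m.+2)) *+ 'C(n, m)).
  by rewrite [in RHS]big_ord_recr /= bin_small// mulr0n addr0.
rewrite [X in X + _ = _]big_ord_recl bin0 mulr1n subn0 -addrA; congr (_ + _).
rewrite -big_split /=; apply: eq_bigr => m _.
by rewrite /bump /= add1n subSS -mulrnDr -binS.
Qed.

End SumComps.

Lemma is_composition_rcons n s m : is_composition n (rcons s m.+1) =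
  (m < n)%N && is_composition (n - m.+1) s.
Proof.
rewrite /is_composition all_rcons /= sumn_rcons.
case: ltnP => [mn|nm] /=; first by rewrite -[in RHS](eqn_add2r m.+1) subnK.
apply/negbTE/negP => /=; rewrite andbC => /andP[/eqP e _].
by move: nm; rewrite -e addnS ltnNge leq_addl.
Qed.

Lemma multN_rcons s m : multN (rcons s m.+1) = (multN s * 'C(sumn s + m, m))%N.
Proof.
rewrite /multN size_rcons; case: s => [|a s].
  (* With a single block the product is empty, and the new factor is C(m, m) = 1. *)
  by rewrite /= !big_geq// binn.
rewrite big_nat_recr //=; congr (_ * _)%N.
  apply: eq_big_nat => r /andP[r1 rs].
  by rewrite -cats1 takel_cat// -cat_cons nth_cat rs.
rewrite take_oversize ?size_rcons// sumn_rcons nth_rcons ltnn eqxx.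
by rewrite addnS addnS addnA.
Qed.

Lemma nat_mulrn (a b : nat) : (a *+ b)%R = (a * b)%N.
Proof. by elim: b => [|b IH]; rewrite ?muln0// mulrS IH mulnS. Qed.

(** The recursion of [comps] on the last entry, [sum_comps_last], is matched with that of [multN],
    [multN_rcons]. *)
Lemma count_comps n s :
  count_mem s (comps n) = (is_composition n s * multN s)%N.
Proof.
elim/last_ind: s n => [|s m IH] n.
  case: n => [|n]; first by rewrite /= /multN big_geq.
  rewrite [is_composition _ _]/= mul0n; apply/count_memPn/negP.
  by move=> /comps_composition.
case: m => [|m].
  rewrite [is_composition _ _](_ : _ = false); last first.
    by rewrite /is_composition all_rcons.
  rewrite mul0n; apply/count_memPn/negP => /comps_composition.
  by rewrite /is_composition all_rcons.
rewrite is_composition_rcons.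
case: n => [|n].
  by apply/count_memPn/negP => /comps_composition; rewrite is_composition_rcons.
(* The count is the sum of the indicator of the sequence, to which the splitting by last entry
   applies; only the summand with the right last entry survives. *)
rewrite -sum1_count big_mkcond (sum_comps_last (V := nat)) /=.
rewrite ltnS; case: leqP => mn /=; last first.
  rewrite big1// => j _; rewrite big1 ?mul0rn// => t _.
  rewrite eqseq_rcons eqSS; case: eqP => // _ /=.
  by case: eqP => // jm; move: (ltn_ord j); rewrite jm ltnS leqNgt mn.
have mo : (m < n.+1)%N by [].
rewrite (bigD1 (Ordinal mo))//= [X in (_ + X)%R]big1 ?addr0; last first.
  move=> j jm; rewrite big1 ?mul0rn// => t _.
  rewrite eqseq_rcons eqSS; case: eqP => // _ /=; case: eqP => // jm'.
  by case/negP: jm; apply/eqP/val_inj.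
rewrite subSS multN_rcons [X in (X *+ _)%R](_ : _ = count_mem s (comps (n - m))).
  rewrite IH.
  have [/andP[_ /eqP ->]|] := boolP (is_composition (n - m) s).
    by rewrite subnK// !mul1n nat_mulrn.
  by rewrite !mul0n mul0rn.
rewrite -sum1_count -big_mkcond; apply: eq_bigl => t.
by rewrite eqseq_rcons eqxx andbT.
Qed.

Lemma mem_composition n s i : is_composition n s -> i \in s -> (0 < i <= n)%N.
Proof.
move=> /andP[ps /eqP <-]; elim: s ps => // a s IH /andP[a0 ps].
rewrite inE => /predU1P[->|/(IH ps)/andP[-> h]]; first by rewrite a0 leq_addr.
by rewrite (leq_trans h)// leq_addl.
Qed.

(** By [count_comps] the multiplicity is a number of repetitions in [comps n], and the list is
    regrouped by length and value. For [n = 0] the left side would miss the empty composition, since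
    lengths start at 1. *)
Lemma sum_compositions (V : nmodType) n (F : seq nat -> V) : (0 < n)%N ->
  (\sum_(1 <= l < n.+1)
     \sum_(s : l.-tuple 'I_n.+1 | is_composition n (map val s))
       F (map val s) *+ multN (map val s) =
   \sum_(s <- comps n) F s)%R.
Proof.
move=> n0; transitivity (\sum_(1 <= l < n.+1)
    \sum_(s : l.-tuple 'I_n.+1) \sum_(t <- comps n | map val s == t) F t)%R.
  apply: eq_big_nat => l _; rewrite big_mkcond; apply: eq_bigr => s _.
  rewrite (eq_bigr (fun=> F (map val s))); last by move=> t /eqP <-.
  rewrite big_const_seq -Monoid.iteropE /=.
  under [count _ _]eq_count do rewrite eq_sym.
  rewrite count_comps; case: ifP => _; last by rewrite mul0n.
  by rewrite mul1n.
under eq_bigr do rewrite (exchange_big_dep xpredT)//=.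
rewrite exchange_big /= !big_seq; apply: eq_bigr => t tn.
have /andP[tpos /eqP tsum] := comps_composition tn.
have tsz : (0 < size t)%N by case: t tsum {tn tpos} n0 => [|//] <-.
have st : (size t <= n)%N.
  rewrite -tsum; elim: t tpos {tn tsum tsz} => //= a t IH /andP[a0 /IH].
  by move=> h; rewrite -add1n leq_add.
have tlt i : i \in t -> (i < n.+1)%N.
  by move=> /(mem_composition (comps_composition tn))/andP[].
rewrite (bigD1_seq (size t)) ?iota_uniq ?mem_index_iota ?tsz//=.
rewrite [X in (_ + X)%R]big1 ?addr0; last first.
  move=> l lt; rewrite big_pred0// => s; apply/negbTE/eqP => st'.
  by move: lt; rewrite -st' size_map size_tuple eqxx.
have tu : size (map (fun i => inord i : 'I_n.+1) t) == size t by rewrite size_map.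
have vt : map val (map (fun i => inord i : 'I_n.+1) t) = t.
  rewrite -map_comp -[RHS]map_id; apply/eq_in_map => i it /=.
  by rewrite inordK// tlt.
rewrite (big_pred1 (Tuple tu))// => s; apply/eqP/eqP => [st'|-> //].
apply: val_inj => /=; rewrite -[in RHS]st' -map_comp -[LHS]map_id.
by apply: eq_map => i /=; rewrite inord_val.
Qed.

(** * Set partitions *)

Lemma is_partitionP n (P : {set {set 'I_n}}) :
  reflect [/\ set0 \notin P, forall x, exists2 A, A \in P & x \in A &
    forall A B x, A \in P -> B \in P -> x \in A -> x \in B -> A = B]
  (is_partition P).
Proof.
apply: (iffP and3P) => [[/eqP cP tP P0]|[P0 cP tP]]; split=> //.
- by move=> x; apply/bigcupP; rewrite -/(cover P) cP inE.
- move=> A B x PA PB xA xB; apply/eqP/negP => /negP AB.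
  by have /pred0P/(_ x)/= := trivIsetP tP A B PA PB AB; rewrite xA xB.
- by apply/eqP/setP => x; rewrite inE; apply/bigcupP; exact: cP.
- apply/trivIsetP => A B PA PB AB; apply/pred0P => x /=; apply/negP => /andP[xA xB].
  by move/eqP: AB; apply; exact: tP xA xB.
Qed.

(** * Adding and removing a lowest element *)

Section LowestElement.
Variable n : nat.
Implicit Types (A B : {set 'I_n}) (P : {set {set 'I_n}}).
Implicit Types (C D : {set 'I_n.+1}) (Q : {set {set 'I_n.+1}}).

(** The option [o] says where the new element [ord0] goes: [Some A] for the block [A], [None] for a
    block of its own. *)
Definition extend_block (o : option {set 'I_n}) A : {set 'I_n.+1} :=
  if o == Some A then ord0 |: (lift ord0 @: A) else lift ord0 @: A.

Definition restrict_block C : {set 'I_n} := [set x | lift ord0 x \in C].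

Lemma lift_extend_block o A x : (lift ord0 x \in extend_block o A) = (x \in A).
Proof.
by rewrite /extend_block; case: ifP => _;
  rewrite ?inE ?(mem_imset _ _ (@lift_inj _ _)).
Qed.

Lemma ord0_extend_block o A : (ord0 \in extend_block o A) = (o == Some A).
Proof.
rewrite /extend_block; case: ifP => _; first by rewrite !inE eqxx.
by apply/negbTE/imsetP => -[x _ /eqP]; rewrite (negbTE (neq_lift _ _)).
Qed.

Lemma extend_blockK o : cancel (extend_block o) restrict_block.
Proof. by move=> A; apply/setP => x; rewrite inE lift_extend_block. Qed.

Lemma restrict_block_ord0 : restrict_block [set ord0] = set0.
Proof.
by apply/setP => x; rewrite !inE eq_sym (negbTE (neq_lift _ _)).
Qed.

Lemma restrict_block0 C :
  restrict_block C = set0 -> ord0 \in C -> C = [set ord0].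
Proof.
move=> /setP C0 oC; apply/setP => x; rewrite inE.
have [y ->|->] := unliftP ord0 x; rewrite ?eqxx//; have := C0 y.
by rewrite !inE eq_sym (negbTE (neq_lift _ _)).
Qed.

Lemma restrict_block_neq0 C :
  C != set0 -> ord0 \notin C -> restrict_block C != set0.
Proof.
move=> /set0Pn[x xC] oC; apply/set0Pn.
have [y xy|x0] := unliftP ord0 x; first by exists y; rewrite inE -xy.
by rewrite -x0 xC in oC.
Qed.

Definition insert_lowest P (o : option {set 'I_n}) : {set {set 'I_n.+1}} :=
  extend_block o @: P :|: (if o is None then [set [set ord0]] else set0).

Definition lowest_choice P (o : option {set 'I_n}) : bool :=
  if o is Some A then A \in P else true.

(** If [ord0] forms a block alone, that block restricts to the empty set; hence the removal of
    [set0] and the test that yields [None]. *)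
Definition remove_lowest Q : {set {set 'I_n}} * option {set 'I_n} :=
  (restrict_block @: Q :\ set0,
   let A := restrict_block (pblock Q ord0) in
   if A == set0 then None else Some A).

Lemma insert_lowestP P o C :
  reflect ((exists2 A, A \in P & C = extend_block o A) \/
           o = None /\ C = [set ord0])
    (C \in insert_lowest P o).
Proof.
rewrite inE; apply: (iffP orP) => -[].
- by move=> /imsetP[A PA ->]; left; exists A.
- by case: o => [?|]; rewrite inE // => /eqP; right.
- by move=> [A PA ->]; left; exact: imset_f.
- by move=> [-> ->]; right; rewrite inE.
Qed.

Lemma insert_lowest_partition P o : is_partition P -> lowest_choice P o ->
  is_partition (insert_lowest P o).
Proof.
move=> /is_partitionP[P0 cP tP] Po; apply/is_partitionP; split.
- apply/negP => /insert_lowestP[[A PA]|[_ /setP/(_ ord0)]]; last first.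
    by rewrite !inE eqxx.
  move=> e; suff A0 : A = set0 by rewrite A0 (negbTE P0) in PA.
  by apply/setP => x; rewrite -(lift_extend_block o) -e !inE.
- move=> x; have [y ->|->] := unliftP ord0 x.
    have [A PA yA] := cP y; exists (extend_block o A); last first.
      by rewrite lift_extend_block.
    by apply/insert_lowestP; left; exists A.
  case: o Po => [A PA|_].
    exists (extend_block (Some A) A); last by rewrite ord0_extend_block.
    by apply/insert_lowestP; left; exists A.
  by exists [set ord0]; [apply/insert_lowestP; right|rewrite inE].
- move=> C D x /insert_lowestP[[A PA ->]|[o0 ->]]
    /insert_lowestP[[B PB ->]|[o0' ->]] //.
  + have [y ->|->] := unliftP ord0 x.
      by rewrite !lift_extend_block => yA yB; rewrite (tP A B y).
    by rewrite !ord0_extend_block => /eqP -> /eqP[->].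
  + have [y ->|->] := unliftP ord0 x.
      by rewrite inE eq_sym (negbTE (neq_lift _ _)).
    by rewrite ord0_extend_block o0'.
  + have [y ->|->] := unliftP ord0 x.
      by rewrite inE eq_sym (negbTE (neq_lift _ _)).
    by rewrite ord0_extend_block o0.
Qed.

Lemma pblock_ord0 Q : is_partition Q ->
  pblock Q ord0 \in Q /\ ord0 \in pblock Q ord0.
Proof.
move=> /and3P[/eqP cQ _ _]; have o0 : ord0 \in cover Q by rewrite cQ inE.
by rewrite pblock_mem// mem_pblock.
Qed.

Lemma remove_lowestP Q A :
  reflect (A != set0 /\ exists2 C, C \in Q & A = restrict_block C)
  (A \in (remove_lowest Q).1).
Proof.
rewrite !inE; apply: (iffP andP) => -[A0].
  by move=> /imsetP[C QC e]; split=> //; exists C.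
by move=> [C QC e]; split=> //; rewrite e imset_f.
Qed.

Lemma remove_lowest_partition Q : is_partition Q ->
  is_partition (remove_lowest Q).1 /\
  lowest_choice (remove_lowest Q).1 (remove_lowest Q).2.
Proof.
move=> pQ; have [QC oC] := pblock_ord0 pQ.
have /is_partitionP[Q0 cQ tQ] := pQ; split.
  apply/is_partitionP; split; first by rewrite !inE eqxx.
    move=> x; have [C QC' xC] := cQ (lift ord0 x).
    exists (restrict_block C); last by rewrite inE.
    apply/remove_lowestP; split; last by exists C.
    by apply/set0Pn; exists x; rewrite inE.
  move=> A B x /remove_lowestP[_ [C QC' ->]] /remove_lowestP[_ [D QD ->]].
  by rewrite !inE => xC xD; rewrite (tQ C D (lift ord0 x)).
rewrite /lowest_choice /=; case: ifPn => // A0.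
by apply/remove_lowestP; split=> //; exists (pblock Q ord0).
Qed.

Lemma restrict_blockK Q C :
  is_partition Q -> C \in Q -> restrict_block C != set0 ->
  extend_block (remove_lowest Q).2 (restrict_block C) = C.
Proof.
move=> pQ QC C0; have [QC0 oC0] := pblock_ord0 pQ.
have /is_partitionP[Q0 cQ tQ] := pQ.
apply/setP => x; have [y ->|->] := unliftP ord0 x.
  by rewrite lift_extend_block inE.
rewrite ord0_extend_block /=.
have [oC|oC] := boolP (ord0 \in C).
  by rewrite (tQ (pblock Q ord0) C ord0)// (negbTE C0) eqxx.
apply/negP; case: ifPn => // _ /eqP[CC].
have /set0Pn[y yC] := C0.
have yC0 : y \in restrict_block (pblock Q ord0) by rewrite CC.
rewrite !inE in yC yC0.
by rewrite -(tQ _ _ _ QC0 QC yC0 yC) oC0 in oC.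
Qed.

Lemma remove_lowestK Q : is_partition Q ->
  insert_lowest (remove_lowest Q).1 (remove_lowest Q).2 = Q.
Proof.
move=> pQ; have [QC0 oC0] := pblock_ord0 pQ.
have /is_partitionP[Q0 cQ tQ] := pQ.
apply/setP => C; apply/insert_lowestP/idP.
  move=> [[A /remove_lowestP[A0 [D QD AD]] ->]|[]].
    by rewrite AD restrict_blockK// -AD.
  by rewrite /=; case: eqP => // /restrict_block0/(_ oC0) <- _ ->.
move=> QC; have [C0|C0] := eqVneq (restrict_block C) set0; last first.
  left; exists (restrict_block C); last by rewrite restrict_blockK.
  by apply/remove_lowestP; split=> //; exists C.
right; have Cn0 : C != set0 by apply: contraNneq Q0 => <-.
have oC : ord0 \in C.
  by apply: contraT => oC; have := restrict_block_neq0 Cn0 oC; rewrite C0 eqxx.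
by rewrite /= (tQ (pblock Q ord0) C ord0)// C0 eqxx (restrict_block0 C0 oC).
Qed.

Lemma insert_lowestK P o : is_partition P -> lowest_choice P o ->
  remove_lowest (insert_lowest P o) = (P, o).
Proof.
move=> pP Po; have pQ := insert_lowest_partition pP Po.
have /is_partitionP[P0 cP tP] := pP.
have [QC0 oC0] := pblock_ord0 pQ.
apply/eqP; rewrite xpair_eqE; apply/andP; split; apply/eqP.
  apply/setP => A; apply/remove_lowestP/idP => [[A0 [C]]|PA].
    move=> /insert_lowestP[[B PB ->]|[_ ->]].
      by rewrite extend_blockK => ->.
    by rewrite restrict_block_ord0 => A0'; rewrite A0' eqxx in A0.
  split; first by apply: contraNneq P0 => <-.
  exists (extend_block o A); last by rewrite extend_blockK.
  by apply/insert_lowestP; left; exists A.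
rewrite /=; case/insert_lowestP: QC0 => [[A PA e]|[o0 ->]]; last first.
  by rewrite restrict_block_ord0 eqxx.
rewrite e ord0_extend_block in oC0; rewrite e extend_blockK.
rewrite (eqP oC0) ifN//; first by apply: contraNneq P0 => <-.
Qed.

Lemma sum_partitionsS (V : nmodType) (F : {set {set 'I_n.+1}} -> V) :
  (\sum_(Q | is_partition Q) F Q =
   \sum_(P | is_partition P) (F (insert_lowest P None) +
      \sum_(A in P) F (insert_lowest P (Some A))))%R.
Proof.
rewrite (reindex_onto (fun p => insert_lowest p.1 p.2) remove_lowest) /=;
  last by move=> Q pQ; exact: remove_lowestK.
rewrite (eq_bigl
  (fun p => is_partition p.1 && lowest_choice p.1 p.2)); last first.
  move=> [P o] /=; apply/andP/andP => [[pQ /eqP e]|[pP Po]].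
    by have := remove_lowest_partition pQ; rewrite e => -[].
  by rewrite insert_lowest_partition// insert_lowestK// eqxx.
rewrite -(pair_big_dep (fun P => is_partition P) lowest_choice
  (fun P o => F (insert_lowest P o))) /=.
apply: eq_bigr => P pP.
rewrite (bigD1 None)//=; congr (_ + _)%R.
(* The default of [odflt] is harmless: the index [None] has been split off. *)
rewrite (reindex_onto Some (odflt set0)) /=; last by move=> [A|]; rewrite ?andbF.
by apply: eq_bigl => A; rewrite eqxx !andbT.
Qed.

End LowestElement.

(** * Blocks in the order of their maxima *)

Definition block_max n (A : {set 'I_n}) : nat := (\max_(i in A) i)%N.

Definition sorted_blocks n (P : {set {set 'I_n}}) : seq {set 'I_n} :=
  sort (fun A B => block_max A <= block_max B)%N (enum P).

Lemma block_sizesE n (P : {set {set 'I_n}}) :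
  block_sizes P = [seq #|A| | A : {set 'I_n} <- sorted_blocks P].
Proof. by []. Qed.

Lemma mem_sorted_blocks n (P : {set {set 'I_n}}) : sorted_blocks P =i P.
Proof. by move=> A; rewrite mem_sort mem_enum. Qed.

Lemma uniq_sorted_blocks n (P : {set {set 'I_n}}) : uniq (sorted_blocks P).
Proof. by rewrite sort_uniq enum_uniq. Qed.

Lemma block_max_mem n (A : {set 'I_n}) : A != set0 ->
  exists2 i : 'I_n, i \in A & block_max A = i.
Proof.
rewrite -card_gt0 => A0.
by have [i iA e] := eq_bigmax_cond (fun i : 'I_n => i : nat) A0; exists i.
Qed.

Lemma block_max_inj n (P : {set {set 'I_n}}) : is_partition P ->
  {in P &, injective (@block_max n)}.
Proof.
move=> /is_partitionP[P0 _ tP] A B PA PB AB.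
have n0 C : C \in P -> C != set0 by move=> PC; apply: contraNneq P0 => <-.
have [i iA ei] := block_max_mem (n0 _ PA).
have [j jB ej] := block_max_mem (n0 _ PB).
apply: (tP A B i) => //; suff -> : i = j by [].
by apply: val_inj => /=; rewrite -ei -ej.
Qed.

Definition block_lt n : rel {set 'I_n} := relpre (@block_max n) ltn.

(** Disjoint nonempty blocks have distinct maxima, so the sorting is strict; a strictly sorted list
    is determined by its members, which gives [sorted_blocks_eq]. *)
Lemma sorted_sorted_blocks n (P : {set {set 'I_n}}) : is_partition P ->
  sorted (@block_lt n) (sorted_blocks P).
Proof.
move=> pP; rewrite -sorted_map ltn_sorted_uniq_leq; apply/andP; split.
  rewrite map_inj_in_uniq ?uniq_sorted_blocks// => A B.
  by rewrite !mem_sorted_blocks; exact: (block_max_inj pP).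
rewrite sorted_map; apply: sort_sorted => A B; exact: leq_total.
Qed.

Lemma sorted_blocks_eq n (P : {set {set 'I_n}}) (s : seq {set 'I_n}) :
  is_partition P -> sorted (@block_lt n) s -> s =i P -> sorted_blocks P = s.
Proof.
move=> pP ss sP; apply: (@irr_sorted_eq _ (@block_lt n)) => //.
- by move=> A B C; exact: ltn_trans.
- by move=> A; exact: ltnn.
- exact: sorted_sorted_blocks.
- by move=> A; rewrite mem_sorted_blocks sP.
Qed.

(** Lifting raises the maximum by one and adding [ord0] cannot change it, so every choice of [o]
    preserves the order of the blocks. *)
Lemma block_max_extend n o (A : {set 'I_n}) : A != set0 ->
  block_max (extend_block o A) = (block_max A).+1.
Proof.
move=> A0; apply/eqP; rewrite eqn_leq; apply/andP; split.
  apply/bigmax_leqP => x; have [y ->|->//] := unliftP ord0 x.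
  rewrite lift_extend_block => yA; rewrite lift0 ltnS.
  exact: (@leq_bigmax_cond _ (mem A) (fun i : 'I_n => i : nat) y).
have [i iA ->] := block_max_mem A0; rewrite -lift0.
apply: (@leq_bigmax_cond _ (mem (extend_block o A))
  (fun i : 'I_n.+1 => i : nat) (lift ord0 i)).
by have := lift_extend_block o A i; rewrite iA.
Qed.

Lemma sorted_extend n o (s : seq {set 'I_n}) : set0 \notin s ->
  sorted (@block_lt n) s -> sorted (@block_lt n.+1) (map (extend_block o) s).
Proof.
move=> s0; apply: (@homo_sorted_in _ _ (fun A => A != set0)).
  by move=> A B A0 B0; rewrite /block_lt /= !block_max_extend.
by apply/allP => A sA; apply: contraNneq s0 => <-.
Qed.

Lemma block_sizes_insert_None n (P : {set {set 'I_n}}) : is_partition P ->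
  block_sizes (insert_lowest P None) = 1%N :: block_sizes P.
Proof.
move=> pP; have /is_partitionP[P0 _ _] := pP.
have s0 : set0 \notin sorted_blocks P by rewrite mem_sorted_blocks.
rewrite !block_sizesE (@sorted_blocks_eq _ _
  ([set ord0] :: map (extend_block None) (sorted_blocks P))).
- rewrite /= cards1 -map_comp; congr (_ :: _); apply: eq_map => A /=.
  by rewrite card_imset//; exact: lift_inj.
- exact: insert_lowest_partition.
- rewrite /= path_sortedE; last by move=> A B C; exact: ltn_trans.
  rewrite sorted_extend ?sorted_sorted_blocks// andbT.
  apply/allP => C /mapP[A sA ->]; rewrite /block_lt /= block_max_extend; last first.
    by apply: contraNneq s0 => <-.
  (* The new singleton has maximum 0, below all lifted maxima, so it comes first. *)
  by rewrite /block_max big_set1.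
- move=> C; rewrite inE; apply/orP/insert_lowestP => -[].
  + by move=> /eqP; right.
  + by move=> /mapP[A sA ->]; left; exists A => //; rewrite -mem_sorted_blocks.
  + by move=> [A PA ->]; right; rewrite map_f// mem_sorted_blocks.
  + by move=> [_ ->]; left.
Qed.

Lemma map_card_extend n (A : {set 'I_n}) (s : seq {set 'I_n}) :
  uniq s -> A \in s ->
  [seq #|B| | B : {set 'I_n.+1} <- map (extend_block (Some A)) s] =
  incr_nth [seq #|B| | B : {set 'I_n} <- s] (index A s).
Proof.
have cA B : #|extend_block (Some A) B| = ((A == B) + #|B|)%N.
  have li : injective (lift (@ord0 n)) by exact: lift_inj.
  rewrite /extend_block; case: eqP => [[<-]|AB].
    rewrite eqxx cardsU1 card_imset//; congr (nat_of_bool _ + _)%N.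
    by apply/imsetP => -[x _ /eqP]; rewrite (negbTE (neq_lift _ _)).
  by rewrite card_imset//; case: eqP => // e; case: AB; rewrite e.
elim: s => //= B s IH /andP[Bs us]; rewrite inE cA => /predU1P[AB|sA].
  subst B; rewrite eqxx add1n; congr (_ :: _); rewrite -map_comp.
  apply/eq_in_map => C sC /=; rewrite cA.
  by case: eqP => // e; rewrite -e (negbTE Bs) in sC.
have /negbTE nAB : A != B by apply: contraNneq Bs => <-.
by rewrite IH// nAB [B == A]eq_sym nAB.
Qed.

Lemma block_sizes_insert_Some n (P : {set {set 'I_n}}) A :
  is_partition P -> A \in P ->
  block_sizes (insert_lowest P (Some A)) =
  incr_nth (block_sizes P) (index A (sorted_blocks P)).
Proof.
move=> pP PA; have /is_partitionP[P0 _ _] := pP.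
have s0 : set0 \notin sorted_blocks P by rewrite mem_sorted_blocks.
rewrite !block_sizesE (@sorted_blocks_eq _ _
  (map (extend_block (Some A)) (sorted_blocks P))).
- by rewrite map_card_extend ?uniq_sorted_blocks ?mem_sorted_blocks.
- exact: insert_lowest_partition.
- by rewrite sorted_extend ?sorted_sorted_blocks.
- move=> C; apply/mapP/insert_lowestP => [[B sB ->]|[[B PB ->]|[]//]].
    by left; exists B => //; rewrite -mem_sorted_blocks.
  by exists B; rewrite ?mem_sorted_blocks.
Qed.

Lemma sum_partitions (V : nmodType) n (F : seq nat -> V) :
  (\sum_(P : {set {set 'I_n}} | is_partition P) F (block_sizes P) =
   \sum_(s <- comps n) F s)%R.
Proof.
elim: n F => [|n IH] F.
  rewrite (big_pred1 set0) => [|P /=].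
    by rewrite big_seq1 block_sizesE /sorted_blocks enum_set0.
  apply/is_partitionP/eqP => [[P0 _ _]|->]; last first.
    by split=> [||A B x]; rewrite ?inE// => -[].
  apply/setP => A; rewrite inE; apply: contraNF P0.
  by rewrite (_ : A = set0)//; apply/setP => -[].
rewrite sum_partitionsS sum_compsS -IH; apply: eq_bigr => P pP.
rewrite block_sizes_insert_None// /step_sum /comp_step big_cons; congr (_ + _)%R.
rewrite (eq_bigr (fun A =>
  F (incr_nth (block_sizes P) (index A (sorted_blocks P))))); last first.
  by move=> A PA; rewrite block_sizes_insert_Some.
rewrite big_map block_sizesE size_map -big_enum /=.
(* Summing over the blocks in sorted order makes the index of a block the position that [comp_step]
   increments. *)
rewrite (perm_big (sorted_blocks P)) /=; last by rewrite perm_sym perm_sort.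
rewrite (big_nth set0) /index_iota subn0 !big_seq; apply: eq_bigr => r.
by rewrite mem_iota => /andP[_ rs]; rewrite index_uniq// uniq_sorted_blocks.
Qed.

From mathcomp Require Import generic_quotient.
From mathcomp Require Import all_classical all_reals all_analysis.
Import numFieldNormedType.Exports.
Local Open Scope ring_scope.
Local Open Scope classical_set_scope.
Local Open Scope quotient_scope.

(** * Smooth maps between normed spaces *)

Section Derivatives.
Context {R : realType}.
Implicit Types U V W Z : normedModType R.

(** Here [g = f + (g - f)], and [g - f] vanishes near [x], so its differential at [x] is 0. *)
Lemma near_eq_differentiable V W (f g : V -> W) (x : V) :
  {near x, f =1 g} -> differentiable f x -> differentiable g x.
Proof.
move=> fg df.
have fgx : f x = g x := nbhs_singleton fg.
suff : differentiable (f + (g - f)) x by rewrite addrC subrK.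
apply: differentiableD => //; set h := g - f.
have h0 : \forall y \near x, h y = 0.
  by apply: filterS fg => y fgy; rewrite /h !fctE fgy subrr.
have hx : h x = 0 := nbhs_singleton h0.
have key : h \o shift x = cst (h x) + (\0 : V -> W) +o_ 0 id.
  apply/eqaddoP => _/posnumP[e].
  have : \forall y \near (0:V), h (y + x) = 0.
    by move: h0; rewrite (near_shift 0 x) /= ; apply: filterS => y /=; rewrite subr0.
  apply: filterS => y hy; rewrite /= !fctE /= hy hx addr0 subr0 normr0.
  by rewrite mulr_ge0.
have c0 : continuous (\0 : {linear V -> W}) by move=> y; exact: cst_continuous.
apply/diff_locallyP; rewrite (diff_unique c0 key); split => //.
Qed.

Lemma derive_comp U V W (f : U -> V) (g : V -> W) x v :
  differentiable f x -> differentiable g (f x) ->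
  'D_v (g \o f) x = 'D_('D_v f x) g (f x).
Proof.
move=> df dg; rewrite deriveE; last exact: differentiable_comp.
by rewrite diff_comp//= -[X in 'd g _ X]deriveE// -deriveE.
Qed.

Lemma derive_lin V W (f : {linear V -> W}) x v :
  continuous f -> 'D_v f x = f v.
Proof.
by move=> cf; rewrite deriveE ?diff_lin//; exact: linear_differentiable.
Qed.

Lemma deriveDv V W (f : V -> W) x v w : differentiable f x ->
  'D_(v + w) f x = 'D_v f x + 'D_w f x.
Proof. by move=> df; rewrite !deriveE// linearD. Qed.

Lemma deriveZv V W (f : V -> W) x a v : differentiable f x ->
  'D_(a *: v) f x = a *: 'D_v f x.
Proof. by move=> df; rewrite !deriveE// linearZ. Qed.

Lemma derive_sumv V W (f : V -> W) x (I : finType) (a : I -> R) (e : I -> V) :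
  differentiable f x ->
  'D_(\sum_i a i *: e i) f x = \sum_i a i *: 'D_(e i) f x.
Proof.
move=> df; rewrite deriveE// linear_sum; apply: eq_bigr => i _.
by rewrite linearZ -deriveE.
Qed.

Lemma derive_pair U V W (f : U -> V) (g : U -> W) x v :
  differentiable f x -> differentiable g x ->
  'D_v (fun y => (f y, g y)) x = ('D_v f x, 'D_v g x).
Proof.
by move=> df dg; rewrite !deriveE ?diff_pair//; exact: differentiable_pair.
Qed.

Section Scale.
Variable W : normedModType R.
(** Scaling is registered as a bilinear map so that the product rule is an instance of the
    differential of a bilinear map. *)
Definition scale_fun (a : R) (w : W) : W := a *: w.
Lemma scale_fun_bilinear :
  bilinear_for
    (GRing.Scale.Law.clone _ _ *:%R _) (GRing.Scale.Law.clone _ _ *:%R _)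
    scale_fun.
Proof.
split=> [u'|u] a x y /=; rewrite /scale_fun.
- by rewrite scalerDl -scalerA.
- by rewrite scalerDr !scalerA mulrC.
Qed.
HB.instance Definition _ := bilinear_isBilinear.Build R R W W _ _ scale_fun
  scale_fun_bilinear.

Lemma scale_fun_continuous : continuous (fun p => scale_fun p.1 p.2).
Proof. exact: scale_continuous. Qed.
End Scale.

Lemma differentiable_scale V W (a : V -> R) (f : V -> W) x :
  differentiable a x -> differentiable f x ->
  differentiable (fun y => a y *: f y) x.
Proof.
move=> da df.
have -> : (fun y => a y *: f y) =
  (fun p => @scale_fun W p.1 p.2) \o (fun y => (a y, f y)) by [].
apply: differentiable_comp; first exact: differentiable_pair.
exact/differentiable_bilin/scale_fun_continuous.
Qed.

Lemma derive_scale V W (a : V -> R) (f : V -> W) x v :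
  differentiable a x -> differentiable f x ->
  'D_v (fun y => a y *: f y) x = 'D_v a x *: f x + a x *: 'D_v f x.
Proof.
move=> da df.
have -> : (fun y => a y *: f y) =
  (fun p => @scale_fun W p.1 p.2) \o (fun y => (a y, f y)) by [].
have dp := differentiable_pair da df.
have ds := @differentiable_bilin _ _ _ _ (@scale_fun W) (a x, f x)
  (@scale_fun_continuous W).
rewrite derive_comp// derive_pair// deriveE// diff_bilin /=; last first.
  exact: scale_fun_continuous.
by rewrite addrC.
Qed.

End Derivatives.

(** * Differentiability of finite order *)

Section DiffN.
Context {R : realType}.
Implicit Types V W Z : normedModType R.

(** An induction on the order, for all functions at once, suits products and composites: their
    derivatives are sums of terms of the same kind, whereas [iter_derive vs] of them has no
    manageable closed form. *)
Fixpoint differentiablen V W (n : nat) (U : set V) (f : V -> W) : Prop :=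
  if n is m.+1 then
    (forall x, U x -> differentiable f x) /\
    forall v, differentiablen m U ('D_v f)
  else True.

Lemma differentiablenP V W (U : set V) (f : V -> W) :
  (forall n, differentiablen n U f) <-> smooth_on U f.
Proof.
split=> [df vs x Ux|sf n].
  suff {df} H : forall n (f : V -> W), differentiablen (size vs + n) U f ->
      differentiablen n U (iter_derive vs f).
    by have /= [+ _] := H 1 _ (df _); apply.
  elim: vs => [//|v vs IH] n {}f; rewrite addSnnS => /IH/= [_]; exact.
elim: n f sf => [//|n IH] f sf; split; first exact: (sf [::]).
move=> v; apply: IH => vs x Ux; have := sf (rcons vs v) x Ux.
by rewrite /iter_derive foldr_rcons.
Qed.

Lemma smooth_on_derive V W (U : set V) (f : V -> W) v :
  smooth_on U f -> smooth_on U ('D_v f).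
Proof.
move=> sf vs x Ux; have := sf (rcons vs v) x Ux.
by rewrite /iter_derive foldr_rcons.
Qed.

Lemma differentiablenS V W (U : set V) (f : V -> W) n :
  differentiablen n.+1 U f -> differentiablen n U f.
Proof. by elim: n f => [//|n IH] f [df df']; split=> // v; exact: IH. Qed.

Lemma open_near V (U : set V) x (P : set V) : open U -> U x ->
  (forall y, U y -> P y) -> \forall y \near x, P y.
Proof. by move=> oU Ux UP; apply: filterS UP _; exact: open_nbhs_nbhs. Qed.

Lemma eq_differentiablen V W (U : set V) (f g : V -> W) n : open U ->
  (forall x, U x -> f x = g x) -> differentiablen n U f -> differentiablen n U g.
Proof.
move=> oU; elim: n f g => [//|n IH] f g fg [df df']; split.
  move=> x Ux; apply: near_eq_differentiable (df x Ux).
  exact: open_near oU Ux fg.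
move=> v; apply: IH (df' v) => x Ux; apply: near_eq_derive.
exact: open_near oU Ux fg.
Qed.

Lemma differentiablen_cst V W (U : set V) (w : W) n : differentiablen n U (cst w).
Proof.
suff /differentiablenP : smooth_on U (cst w) by [].
by move=> vs x _; have [w' ->] := iter_derive_cst vs w.
Qed.

Lemma differentiablenD V W (U : set V) (f g : V -> W) n : open U ->
  differentiablen n U f -> differentiablen n U g ->
  differentiablen n U (fun x => f x + g x).
Proof.
move=> oU; elim: n f g => [//|n IH] f g [df df'] [dg dg']; split.
  by move=> x Ux; apply: differentiableD; [exact: df|exact: dg].
move=> v; apply: eq_differentiablen (IH _ _ (df' v) (dg' v)) => // x Ux.
by rewrite [in RHS]deriveD//; apply: diff_derivable; [exact: df|exact: dg].
Qed.

Lemma differentiablen_sum V W (U : set V) (I : finType) (f : I -> V -> W) n :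
  open U -> (forall i, differentiablen n U (f i)) ->
  differentiablen n U (fun x => \sum_i f i x).
Proof.
move=> oU df; elim: (index_enum I) => [|i s IH].
  under eq_fun do rewrite big_nil; exact: differentiablen_cst.
by under eq_fun do rewrite big_cons; exact: differentiablenD.
Qed.

Lemma differentiablenZ V W (U : set V) (a : V -> R) (f : V -> W) n : open U ->
  differentiablen n U a -> differentiablen n U f ->
  differentiablen n U (fun x => a x *: f x).
Proof.
move=> oU; elim: n a f => [//|n IH] a f da df; have [d1a d2a] := da.
have [d1f d2f] := df; split.
  by move=> x Ux; apply: differentiable_scale; [exact: d1a|exact: d1f].
move=> v; have H := differentiablenD oU (IH _ _ (d2a v) (differentiablenS df))
  (IH _ _ (differentiablenS da) (d2f v)).
apply: eq_differentiablen H => // x Ux.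
by rewrite derive_scale//; [exact: d1a|exact: d1f].
Qed.

Lemma differentiablen_lin V W Z (U : set V) (f : V -> W) (L : {linear W -> Z}) n :
  open U -> continuous L ->
  differentiablen n U f -> differentiablen n U (L \o f).
Proof.
move=> oU cL; have dL y : differentiable L y by exact: linear_differentiable.
elim: n f => [//|n IH] f [df df']; split.
  by move=> x Ux; apply: differentiable_comp; [exact: df|].
move=> v; apply: eq_differentiablen (IH _ (df' v)) => // x Ux.
by rewrite derive_comp ?derive_lin//; exact: df.
Qed.

Lemma differentiablen_pair V W Z (U : set V) (f : V -> W) (g : V -> Z) n :
  open U -> differentiablen n U f -> differentiablen n U g ->
  differentiablen n U (fun x => (f x, g x)).
Proof.
move=> oU; elim: n f g => [//|n IH] f g [df df'] [dg dg']; split.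
  by move=> x Ux; apply: differentiable_pair; [exact: df|exact: dg].
move=> v; apply: eq_differentiablen (IH _ _ (df' v) (dg' v)) => // x Ux.
by rewrite derive_pair//; [exact: df|exact: dg].
Qed.

(** The chain rule yields ['D_('D_v g x) f (g x)], with a direction depending on [x]. Coordinates
    turn it into a sum of scalar functions times ['D_(e i) f \o g], to which an induction hypothesis
    for composites applies. *)
Definition finite_coordinates W : Prop :=
  exists (I : finType) (e : I -> W) (c : I -> {linear W -> R}),
    (forall i, continuous (c i)) /\ forall w, w = \sum_i c i w *: e i.

Lemma differentiablen_comp V W Z (U : set V) (O : set W) (g : V -> W)
    (f : W -> Z) n : finite_coordinates W ->
  open U -> (forall x, U x -> O (g x)) ->
  smooth_on O f -> differentiablen n U g -> differentiablen n U (f \o g).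
Proof.
move=> [I [e [c [cc ce]]]] oU UO.
elim: n f => [//|n IH] f sf dg; have [d1g d2g] := dg; split.
  by move=> x Ux; apply: differentiable_comp; [exact: d1g|exact/(sf [::])/UO].
move=> v.
have H : differentiablen n U
    (fun x => \sum_i (c i \o 'D_v g) x *: ('D_(e i) f \o g) x).
  apply: differentiablen_sum => // i; apply: differentiablenZ => //.
    by apply: (differentiablen_lin (L := c i) oU (cc i)); exact: d2g.
  by apply: IH; [exact: smooth_on_derive|exact: differentiablenS].
apply: eq_differentiablen H => // x Ux.
have dfx : differentiable f (g x) by exact/(sf [::])/UO.
rewrite [in RHS]derive_comp//; last exact: d1g.
by rewrite [in RHS](ce ('D_v g x)) derive_sumv.
Qed.

Lemma finite_coordinatesR : finite_coordinates R.
Proof.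
exists unit, (fun=> 1), (fun=> idfun); split=> [_ x|w]; first exact: cvg_id.
by rewrite (bigD1 tt)//= big1 ?addr0 ?[_ *: _]mulr1// => -[].
Qed.

Lemma finite_coordinates_rV d : finite_coordinates 'rV[R]_d.
Proof.
have coordL i : {f : {linear 'rV[R]_d -> R} | forall v, f v = v ord0 i}.
  have @f : {linear 'rV[R]_d -> R}.
    by exists (fun N : 'rV[R]_d => N ord0 i); do 2![eexists]; do ?[constructor];
     rewrite ?mxE// => ? *; rewrite ?mxE//; move=> ?; rewrite !mxE.
  by exists f.
exists 'I_d, (delta_mx ord0), (fun i => sval (coordL i)); split=> [i|w].
  have -> : (sval (coordL i) : 'rV[R]_d -> R) = fun v => v ord0 i.
    by apply/funext => v; rewrite (svalP (coordL i)).
  exact: coord_continuous.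
rewrite [LHS]row_sum_delta; apply: eq_bigr => i _.
by rewrite (svalP (coordL i)).
Qed.

Lemma finite_coordinates_prod V W :
  finite_coordinates V -> finite_coordinates W ->
  finite_coordinates (V * W)%type.
Proof.
move=> [I [e [c [cc ce]]]] [J [f [b [cb bf]]]].
pose g (k : I + J) : V * W :=
  match k with inl i => (e i, 0) | inr j => (0, f j) end.
pose l (k : I + J) : {linear (V * W)%type -> R} :=
  match k with inl i => c i \o fst | inr j => b j \o snd end.
exists (I + J)%type, g, l; split=> [[i|j] p /=|w].
- by apply: continuous_comp; [exact: cvg_fst|exact: cc].
- by apply: continuous_comp; [exact: cvg_snd|exact: cb].
rewrite big_sumType/=.
case: w => v w; rewrite {1}(ce v) {1}(bf w) /=.
have -> : \sum_i c i v *: (e i, 0 : W) = (\sum_i c i v *: e i, 0).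
  elim/big_rec2: _ => // i y1 y2 _ ->.
  by congr pair; rewrite /= ?scaler0 ?addr0.
have -> : \sum_j b j w *: (0 : V, f j) = (0, \sum_j b j w *: f j).
  elim/big_rec2: _ => // i y1 y2 _ ->.
  by congr pair; rewrite /= ?scaler0 ?addr0.
by congr pair; rewrite /= ?addr0 ?add0r.
Qed.

End DiffN.

(** * Smoothness at a point *)

Section SmoothAt.
Context {R : realType}.
Implicit Types V W Z : normedModType R.

Definition smooth_at V W (f : V -> W) (x : V) : Prop :=
  exists2 U, open_nbhs x U & smooth_on U f.

Lemma smooth_at_on V W (U : set V) (f : V -> W) x :
  nbhs x U -> smooth_on U f -> smooth_at f x.
Proof.
move=> Ux sf; exists U^°; last by move=> vs y Uy; apply: sf; exact: interior_subset.
by split; [exact: open_interior|exact: nbhs_singleton (nbhs_interior Ux)].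
Qed.

Lemma smooth_at_near V W (f : V -> W) x :
  smooth_at f x -> \forall y \near x, smooth_at f y.
Proof.
by move=> [U [oU Ux] sf]; apply: (open_near oU Ux) => y Uy; exists U.
Qed.

Lemma smooth_at_differentiable V W (f : V -> W) x :
  smooth_at f x -> differentiable f x.
Proof. by move=> [U [_ Ux] sf]; exact: (sf [::]). Qed.

Lemma smooth_at_continuous V W (f : V -> W) x :
  smooth_at f x -> {for x, continuous f}.
Proof. by move=> /smooth_at_differentiable/differentiable_continuous. Qed.

Lemma smooth_atP V W (f : V -> W) x : smooth_at f x <->
  exists2 U, open_nbhs x U & forall n, differentiablen n U f.
Proof. by split=> -[U Ux /differentiablenP sf]; exists U. Qed.

Lemma smooth_on_subset V W (U O : set V) (f : V -> W) :
  O `<=` U -> smooth_on U f -> smooth_on O f.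
Proof. by move=> OU sf vs y Oy; apply: sf; exact: OU. Qed.

Lemma near_eq_smooth_at V W (f g : V -> W) x : {near x, f =1 g} ->
  smooth_at f x -> smooth_at g x.
Proof.
move=> fg [U Ux sf].
have [B Bx Bfg] : exists2 B, open_nbhs x B & forall y, B y -> f y = g y.
  by move: fg; rewrite /prop_near1 nbhsE => -[B oB BS]; exists B.
apply/smooth_atP; exists (U `&` B); first exact: open_nbhsI.
have oUB : open (U `&` B) by apply: openI; [case: Ux|case: Bx].
move=> n; apply: eq_differentiablen (oUB) _ _ => [y [_ By]|]; first exact: Bfg.
by move: n; apply/differentiablenP; apply: smooth_on_subset sf => y [].
Qed.

Lemma smooth_at_derive V W (f : V -> W) x v :
  smooth_at f x -> smooth_at ('D_v f) x.
Proof. by move=> [U Ux sf]; exists U => //; exact: smooth_on_derive. Qed.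

Lemma smooth_at_cst V W (w : W) (x : V) : smooth_at (cst w) x.
Proof.
exists setT; first by split => //; exact: openT.
by apply/differentiablenP => n; exact: differentiablen_cst.
Qed.

(** Transfers a closure rule on open sets to points, by intersecting the two neighbourhoods. *)
Lemma smooth_at2 V W1 W2 W3 (f : V -> W1) (g : V -> W2) (h : V -> W3) x :
  (forall U, open U -> forall n, differentiablen n U f ->
    differentiablen n U g -> differentiablen n U h) ->
  smooth_at f x -> smooth_at g x -> smooth_at h x.
Proof.
move=> H [U Ux sf] [B Bx sg]; apply/smooth_atP.
exists (U `&` B); first exact: open_nbhsI.
move=> n; apply: H; first by apply: openI; [case: Ux|case: Bx].
  by move: n; apply/differentiablenP; apply: smooth_on_subset sf => y [].
by move: n; apply/differentiablenP; apply: smooth_on_subset sg => y [].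
Qed.

Lemma smooth_atD V W (f g : V -> W) x : smooth_at f x -> smooth_at g x ->
  smooth_at (fun y => f y + g y) x.
Proof. by apply: smooth_at2 => U oU n; exact: differentiablenD. Qed.

Lemma smooth_atZ V W (a : V -> R) (f : V -> W) x :
  smooth_at a x -> smooth_at f x -> smooth_at (fun y => a y *: f y) x.
Proof. by apply: smooth_at2 => U oU n; exact: differentiablenZ. Qed.

Lemma smooth_at_sum V W (I : finType) (f : I -> V -> W) x :
  (forall i, smooth_at (f i) x) -> smooth_at (fun y => \sum_i f i y) x.
Proof.
move=> sf; elim: (index_enum I) => [|i s IH].
  under eq_fun do rewrite big_nil; exact: smooth_at_cst.
by under eq_fun do rewrite big_cons; exact: smooth_atD.
Qed.

Lemma smooth_at_pair V W Z (f : V -> W) (g : V -> Z) x :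
  smooth_at f x -> smooth_at g x -> smooth_at (fun y => (f y, g y)) x.
Proof. by apply: smooth_at2 => U oU n; exact: differentiablen_pair. Qed.

Lemma smooth_at_lin_comp V W Z (f : V -> W) (L : {linear W -> Z}) x :
  continuous L -> smooth_at f x -> smooth_at (L \o f) x.
Proof.
move=> cL sf; apply: smooth_at2 (sf) (sf) => U oU n df _.
exact: differentiablen_lin.
Qed.

Lemma smooth_at_id V (x : V) : smooth_at id x.
Proof.
exists setT; first by split => //; exact: openT.
apply/differentiablenP => -[//|n]; split; first by move=> y _; exact: ex_diff.
move=> v; apply: (@eq_differentiablen _ _ _ _ (cst v)); first exact: openT.
  by move=> y _; rewrite derive_id.
exact: differentiablen_cst.
Qed.

Lemma smooth_at_lin V W (L : {linear V -> W}) x :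
  continuous L -> smooth_at L x.
Proof. by move=> cL; apply: (smooth_at_lin_comp cL (smooth_at_id x)). Qed.

Lemma smooth_at_fst V W (p : V * W) : smooth_at fst p.
Proof. by apply: (@smooth_at_lin _ _ fst) => q; exact: cvg_fst. Qed.

Lemma smooth_at_snd V W (p : V * W) : smooth_at snd p.
Proof. by apply: (@smooth_at_lin _ _ snd) => q; exact: cvg_snd. Qed.

Lemma smooth_at_comp V W Z (g : V -> W) (f : W -> Z) x : finite_coordinates W ->
  smooth_at g x -> smooth_at f (g x) -> smooth_at (f \o g) x.
Proof.
move=> fW sg [B0 [oB0 Bgx] sf]; have [U [oU Ux] sgU] := sg.
have : nbhs x (U `&` g @^-1` B0).
  apply: filterI; first exact: open_nbhs_nbhs.
  by apply: (smooth_at_continuous sg); exact: open_nbhs_nbhs.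
rewrite nbhsE => -[B [oB Bx] BUO]; apply/smooth_atP; exists B => // n.
apply: (differentiablen_comp fW oB _ sf) => [y /BUO[]//|].
by move: n; apply/differentiablenP; apply: smooth_on_subset sgU => y /BUO[].
Qed.

End SmoothAt.

(** * Jets at 0 of curves in normed spaces *)

Section CurveJets.
Context {R : realType}.
Implicit Types V W : normedModType R.

Lemma smooth_at_derive1 V (f : R -> V) (t : R) : smooth_at f t -> smooth_at f^`() t.
Proof.
move=> sf; rewrite (_ : f^`() = 'D_1 f); first exact: smooth_at_derive.
by apply/funext => s; rewrite derive1E.
Qed.

Lemma smooth_at_derive1n V (f : R -> V) (t : R) n :
  smooth_at f t -> smooth_at f^`(n) t.
Proof. by move=> sf; elim: n => //= n; exact: smooth_at_derive1. Qed.

Lemma near_eq_derive1 V (f g : R -> V) (t : R) : {near t, f =1 g} ->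
  {near t, f^`() =1 g^`()}.
Proof.
move=> /near_join; apply: filterS => s fg.
by rewrite !derive1E; exact: near_eq_derive.
Qed.

Lemma near_eq_derive1n V (f g : R -> V) (t : R) n : {near t, f =1 g} ->
  {near t, f^`(n) =1 g^`(n)}.
Proof. by move=> fg; elim: n => //= n; exact: near_eq_derive1. Qed.

Definition same_jet V (k : nat) (f g : R -> V) : Prop :=
  forall i, (i <= k)%N -> f^`(i) 0 = g^`(i) 0.

Lemma same_jetS V k (f g : R -> V) :
  same_jet k.+1 f g <-> f 0 = g 0 /\ same_jet k f^`() g^`().
Proof.
split=> [fg|[fg0 fg] [//|i] ik]; last by rewrite !derive1Sn; exact: fg.
by split=> [|i ik]; [exact: (fg 0)|have := fg i.+1; rewrite !derive1Sn; exact].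
Qed.

Lemma same_jet0 V k (f g : R -> V) : same_jet k f g -> f 0 = g 0.
Proof. by move=> fg; exact: (fg 0). Qed.

Lemma same_jet0P V (f g : R -> V) : f 0 = g 0 -> same_jet 0 f g.
Proof. by move=> fg [|//]. Qed.

Lemma same_jet_sym V k (f g : R -> V) : same_jet k f g -> same_jet k g f.
Proof. by move=> fg i ik; rewrite fg. Qed.

Lemma same_jet_trans V k (f g h : R -> V) :
  same_jet k f g -> same_jet k g h -> same_jet k f h.
Proof. by move=> fg gh i ik; rewrite fg// gh. Qed.

Lemma same_jet_leq V k j (f g : R -> V) : (j <= k)%N ->
  same_jet k f g -> same_jet j f g.
Proof. by move=> jk fg i ij; apply: fg; exact: leq_trans jk. Qed.

Lemma near_eq_same_jet V k (f g : R -> V) : {near (0 : R), f =1 g} -> same_jet k f g.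
Proof. by move=> fg i _; exact: nbhs_singleton (near_eq_derive1n i fg). Qed.

Arguments near_eq_same_jet {V} k {f g}.

(** The equality holds near [t], not only at [t], so that it can be differentiated again. *)
Lemma near_derive1D V (f g : R -> V) (t : R) : smooth_at f t -> smooth_at g t ->
  {near t, (fun s => f s + g s)^`() =1 fun s => derive1 f s + derive1 g s}.
Proof.
move=> /smooth_at_near sf /smooth_at_near sg.
apply: filterS2 sf sg => s /smooth_at_differentiable df.
move=> /smooth_at_differentiable dg; rewrite !derive1E.
by rewrite deriveD//; exact: diff_derivable.
Qed.

Lemma near_derive1Z V (a : R -> R) (f : R -> V) (t : R) :
  smooth_at a t -> smooth_at f t ->
  {near t, (fun s => a s *: f s)^`() =1
    fun s => derive1 a s *: f s + a s *: derive1 f s}.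
Proof.
move=> /smooth_at_near sa /smooth_at_near sf.
apply: filterS2 sa sf => s /smooth_at_differentiable da.
move=> /smooth_at_differentiable df; rewrite !derive1E.
by rewrite derive_scale.
Qed.

Lemma same_jetD V k (f f' g g' : R -> V) :
  smooth_at f 0 -> smooth_at f' 0 -> smooth_at g 0 -> smooth_at g' 0 ->
  same_jet k f f' -> same_jet k g g' ->
  same_jet k (fun s => f s + g s) (fun s => f' s + g' s).
Proof.
elim: k f f' g g' => [|k IH] f f' g g' sf sf' sg sg' ff' gg'.
  by apply: same_jet0P; rewrite (same_jet0 ff') (same_jet0 gg').
have [f0 f1] := (same_jetS _ _ _).1 ff'; have [g0 g1] := (same_jetS _ _ _).1 gg'.
apply/same_jetS; split; first by rewrite f0 g0.
have h := near_eq_same_jet k (near_derive1D sf sg).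
have h' := near_eq_same_jet k (near_derive1D sf' sg').
apply: same_jet_trans h (same_jet_trans _ (same_jet_sym h')).
by apply: IH => //; exact: smooth_at_derive1.
Qed.

Lemma same_jetZ V k (a a' : R -> R) (f f' : R -> V) :
  smooth_at a 0 -> smooth_at a' 0 -> smooth_at f 0 -> smooth_at f' 0 ->
  same_jet k a a' -> same_jet k f f' ->
  same_jet k (fun s => a s *: f s) (fun s => a' s *: f' s).
Proof.
elim: k a a' f f' => [|k IH] a a' f f' sa sa' sf sf' aa' ff'.
  by apply: same_jet0P; rewrite (same_jet0 ff') (same_jet0 aa').
have [a0 a1] := (same_jetS _ _ _).1 aa'; have [f0 f1] := (same_jetS _ _ _).1 ff'.
apply/same_jetS; split; first by rewrite a0 f0.
have h := near_eq_same_jet k (near_derive1Z sa sf).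
have h' := near_eq_same_jet k (near_derive1Z sa' sf').
apply: same_jet_trans h (same_jet_trans _ (same_jet_sym h')).
have d := @smooth_at_derive1; apply: same_jetD; try apply: smooth_atZ; auto.
- by apply: IH; auto; apply: same_jet_leq ff'.
- by apply: IH; auto; apply: same_jet_leq aa'.
Qed.

Lemma same_jet_sum V k (I : finType) (f g : I -> R -> V) :
  (forall i, smooth_at (f i) 0) -> (forall i, smooth_at (g i) 0) ->
  (forall i, same_jet k (f i) (g i)) ->
  same_jet k (fun s => \sum_i f i s) (fun s => \sum_i g i s).
Proof.
move=> sf sg fg.
suff [] : [/\ smooth_at (fun s => \sum_i f i s) 0,
    smooth_at (fun s => \sum_i g i s) 0 &
    same_jet k (fun s => \sum_i f i s) (fun s => \sum_i g i s)] by [].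
elim: (index_enum I) => [|i s [s1 s2 IH]].
  have E (h : I -> R -> V) : (fun t => \sum_(j <- [::]) h j t) = cst 0.
    by apply/funext => t; rewrite big_nil.
  by rewrite !E; split; [exact: smooth_at_cst|exact: smooth_at_cst|].
have E (h : I -> R -> V) : (fun t => \sum_(j <- i :: s) h j t) =
    fun t => h i t + \sum_(j <- s) h j t.
  by apply/funext => t; rewrite big_cons.
rewrite !E.
by split; [exact: smooth_atD|exact: smooth_atD|exact: same_jetD].
Qed.

Lemma same_jet_lin V W k (L : {linear V -> W}) (f g : R -> V) :
  continuous L -> smooth_at f 0 -> smooth_at g 0 -> same_jet k f g ->
  same_jet k (L \o f) (L \o g).
Proof.
move=> cL; have dL y : differentiable L y by exact: linear_differentiable.
have H h : smooth_at h 0 -> {near (0 : R), (L \o h)^`() =1 L \o h^`()}.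
  move=> /smooth_at_near; apply: filterS => s /smooth_at_differentiable dh.
  by rewrite !derive1E /= derive_comp// derive_lin// derive1E.
elim: k f g => [|k IH] f g sf sg fg.
  by apply: same_jet0P; rewrite /= (same_jet0 fg).
have [f0 f1] := (same_jetS _ _ _).1 fg.
apply/same_jetS; split; first by rewrite /= f0.
apply: same_jet_trans (near_eq_same_jet k (H _ sf)) _.
apply: same_jet_trans (same_jet_sym (near_eq_same_jet k (H _ sg))).
by apply: IH => //; exact: smooth_at_derive1.
Qed.

(** In coordinates the derivative of [F \o f] is a sum of products of components of the derivative
    of [f] with ['D_(e i) F \o f]. Only jets of order [k] of these enter at order [k.+1], so
    induction on the order, with [F] varying, closes. *)
Lemma same_jet_comp V W k (F : V -> W) (f g : R -> V) :
  finite_coordinates V ->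
  smooth_at f 0 -> smooth_at g 0 -> smooth_at F (f 0) -> same_jet k f g ->
  same_jet k (F \o f) (F \o g).
Proof.
move=> fV; have [I [e [c [cc ce]]]] := fV.
have H (G : V -> W) h : smooth_at h 0 -> smooth_at G (h 0) ->
    {near (0 : R), (G \o h)^`() =1
      fun s => \sum_i (c i \o derive1 h) s *: ('D_(e i) G \o h) s}.
  move=> sh /smooth_at_near sG.
  have {}sG : \forall s \near 0, smooth_at G (h s).
    exact: (smooth_at_continuous sh).
  apply: filterS2 (smooth_at_near sh) sG => s /smooth_at_differentiable dh.
  move=> /smooth_at_differentiable dG; rewrite derive1E derive_comp//.
  by rewrite [in LHS](ce ('D_1 h s)) derive_sumv// /= -derive1E.
elim: k F f g => [|k IH] F f g sf sg sF fg.
  by apply: same_jet0P; rewrite /= (same_jet0 fg).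
have [f0 f1] := (same_jetS _ _ _).1 fg.
apply/same_jetS; split; first by rewrite /= f0.
apply: same_jet_trans (near_eq_same_jet k (H _ _ sf sF)) _.
rewrite f0 in sF.
apply: same_jet_trans (same_jet_sym (near_eq_same_jet k (H _ _ sg sF))).
have s1 h i : smooth_at h 0 -> smooth_at (c i \o h^`()) 0.
  by move=> sh; apply: smooth_at_lin_comp => //; exact: smooth_at_derive1.
have s2 h i : smooth_at h 0 -> smooth_at F (h 0) ->
    smooth_at ('D_(e i) F \o h) 0.
  by move=> sh sFh; apply: smooth_at_comp => //; exact: smooth_at_derive.
have sF' : smooth_at F (f 0) by rewrite f0.
apply: same_jet_sum => i; [by apply: smooth_atZ; auto..|].
apply: same_jetZ; auto.
- by apply: same_jet_lin => //; exact: smooth_at_derive1.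
- by apply: IH => //; [exact: smooth_at_derive|exact: same_jet_leq fg].
Qed.

Lemma near_derive1_pair V W (f : R -> V) (g : R -> W) (t : R) :
  smooth_at f t -> smooth_at g t ->
  {near t, (fun s => (f s, g s))^`() =1 fun s => (derive1 f s, derive1 g s)}.
Proof.
move=> /smooth_at_near sf /smooth_at_near sg.
apply: filterS2 sf sg => s /smooth_at_differentiable df.
move=> /smooth_at_differentiable dg; rewrite !derive1E.
by rewrite derive_pair.
Qed.

Lemma same_jet_pair V W k (f f' : R -> V) (g g' : R -> W) :
  smooth_at f 0 -> smooth_at f' 0 -> smooth_at g 0 -> smooth_at g' 0 ->
  same_jet k f f' -> same_jet k g g' ->
  same_jet k (fun s => (f s, g s)) (fun s => (f' s, g' s)).
Proof.
elim: k f f' g g' => [|k IH] f f' g g' sf sf' sg sg' ff' gg'.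
  by apply: same_jet0P; rewrite (same_jet0 ff') (same_jet0 gg').
have [f0 f1] := (same_jetS _ _ _).1 ff'; have [g0 g1] := (same_jetS _ _ _).1 gg'.
apply/same_jetS; split; first by rewrite f0 g0.
have h := near_eq_same_jet k (near_derive1_pair sf sg).
have h' := near_eq_same_jet k (near_derive1_pair sf' sg').
apply: same_jet_trans h (same_jet_trans _ (same_jet_sym h')).
by apply: IH => //; exact: smooth_at_derive1.
Qed.

(** There are [k] coefficients, hence the degree is below [k]; prescribing a jet of order [k] takes
    [taylor a k.+1]. *)
Definition taylor V (a : nat -> V) (k : nat) (t : R) : V :=
  \sum_(i < k) (t ^+ i / i`!%:R) *: a i.

Lemma smooth_at_taylor V (a : nat -> V) k t : smooth_at (taylor a k) t.
Proof.
apply: smooth_at_sum => i; apply: smooth_atZ; last exact: smooth_at_cst.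
under eq_fun do rewrite mulrC.
apply: (@smooth_atZ _ _ _ (cst _)); first exact: smooth_at_cst.
elim: (i : nat) => [|n IH]; first exact: smooth_at_cst.
under eq_fun do rewrite exprS.
by apply: (@smooth_atZ _ _ _ id) => //; exact: smooth_at_id.
Qed.

Lemma taylor_derive1 V (a : nat -> V) k :
  (taylor a k.+1)^`() = taylor (fun i => a i.+1) k.
Proof.
apply/funext => t; rewrite derive1E.
have -> : taylor a k.+1 = fun s : R =>
    (\sum_(i < k.+1) (fun s : R => (s ^+ i / i`!%:R) *: a i)) s.
  by apply/funext => s; rewrite fct_sumE.
have d (i : nat) : is_derive t (1 : R) (fun s : R => s ^+ i / i`!%:R)
    (i%:R * t ^+ i.-1 / i`!%:R).
  have -> : (fun s : R => s ^+ i / i`!%:R) =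
      (i`!%:R)^-1 *: (@GRing.exp R ^~ i).
    by apply/funext => s; rewrite mulrC.
  apply: is_derive_eq; first exact/is_deriveZ/derivableP/exprn_derivable.
  by rewrite exp_derive /= [_ *: 1]mulr1 [LHS]mulrC.
have dd (i : nat) : is_derive t (1 : R) (fun s : R => (s ^+ i / i`!%:R) *: a i)
    ((i%:R * t ^+ i.-1 / i`!%:R) *: a i).
  have di : differentiable (fun s : R => s ^+ i / i`!%:R) t.
    by apply/derivable1_diffP; exact: ex_derive.
  have dc : differentiable (cst (a i) : R -> V) t by [].
  split; first exact/derivable1_diffP/(differentiable_scale di dc).
  by rewrite (derive_scale _ di dc) derive_cst scaler0 addr0 derive_val.
rewrite (@derive_sum _ _ _ _
  (fun i : 'I_k.+1 => (fun s : R => (s ^+ i / i`!%:R) *: a i))) /=.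
rewrite (eq_bigr (fun i : 'I_k.+1 => (i%:R * t ^+ i.-1 / i`!%:R) *: a i)).
  rewrite big_ord_recl mul0r mul0r scale0r add0r; apply: eq_bigr => i _.
  congr (_ *: _).
  by rewrite lift0 /= factS natrM -mulf_div divff ?mul1r// pnatr_eq0.
  by move=> i _; rewrite derive_val.
by move=> i; exact: ex_derive.
Qed.

Lemma taylor_derive1n V (a : nat -> V) k i : (i < k)%N ->
  (taylor a k)^`(i) 0 = a i.
Proof.
elim: k a i => [//|k IH] a [_|i ik].
  rewrite derive1n0 /taylor big_ord_recl expr0 divr1 scale1r big1 ?addr0// => i _.
  by rewrite expr0n mul0r scale0r.
by rewrite derive1Sn taylor_derive1 IH.
Qed.

End CurveJets.

Arguments near_eq_same_jet {R V} k {f g}.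

(** * Smooth maps into a Lie group *)

Section DirectionalDerivative.
Context {R : realType}.
Implicit Types V W Z : normedModType R.

(** Base point and direction both vary. [Ad], [right_log_derive], [logder_map] and [velocity_map]
    are all of this form, for a smooth [K] built from the group operations. *)
Lemma smooth_at_dirderive V W Z (K : V -> W) (h l : Z -> V) x :
  finite_coordinates V -> smooth_at h x -> smooth_at l x ->
  smooth_at K (h x) -> smooth_at (fun y => 'D_(l y) K (h y)) x.
Proof.
move=> fV sh sl sK; have [I [e [c [cc ce]]]] := fV.
have nK : \forall y \near x, smooth_at K (h y).
  exact: (smooth_at_continuous sh) (smooth_at_near sK).
have H : smooth_at (fun y => \sum_i (c i \o l) y *: ('D_(e i) K \o h) y) x.
  apply: smooth_at_sum => i; apply: smooth_atZ.
    by apply: smooth_at_lin_comp sl; exact: cc.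
  by apply: (smooth_at_comp fV sh); exact: smooth_at_derive.
apply: near_eq_smooth_at H; apply: filterS nK => y /smooth_at_differentiable dK.
by rewrite [in RHS](ce (l y)) derive_sumv.
Qed.

Lemma derive_curve V W (f : R -> V) (g : V -> W) (t : R) :
  differentiable f t -> differentiable g (f t) ->
  'D_1 (g \o f) t = 'D_('D_1 f t) g (f t).
Proof. exact: derive_comp. Qed.

Lemma derive_pair_curve V W (f : R -> V) (g : R -> W) (t : R) :
  differentiable f t -> differentiable g t ->
  'D_1 (fun s => (f s, g s)) t = ('D_1 f t, 'D_1 g t).
Proof. exact: derive_pair. Qed.

Lemma derive_pairl V W Z (K : V * W -> Z) (x : V) (y : W) v :
  differentiable K (x, y) ->
  'D_(v, 0) K (x, y) = 'D_v (fun w => K (w, y)) x.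
Proof.
move=> dK; have dc : differentiable (cst y) x by [].
have di : differentiable id x by [].
have dp := differentiable_pair di dc.
have e : 'D_v (fun w : V => (w, y)) x = (v, 0).
  by have := derive_pair v di dc; rewrite derive_id derive_cst.
by rewrite -e; apply/esym/(derive_comp v dp).
Qed.

Lemma derive_pairr V W Z (K : V * W -> Z) (x : V) (y : W) v :
  differentiable K (x, y) ->
  'D_(0, v) K (x, y) = 'D_v (fun w => K (x, w)) y.
Proof.
move=> dK; have dc : differentiable (cst x) y by [].
have di : differentiable id y by [].
have dp := differentiable_pair dc di.
have e : 'D_v (fun w : W => (x, w)) y = (0, v).
  by have := derive_pair v dc di; rewrite derive_id derive_cst.
by rewrite -e; apply/esym/(derive_comp v dp).
Qed.

Lemma derive1_sum_scale W (I : finType) (a : I -> R -> R) (f : I -> R -> W)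
    (t : R) :
  (forall i, differentiable (a i) t) -> (forall i, differentiable (f i) t) ->
  derive1 (fun s => \sum_i a i s *: f i s) t =
  \sum_i ('D_1 (a i) t *: f i t + a i t *: 'D_1 (f i) t).
Proof.
move=> da df; rewrite derive1E.
have H i : is_derive t (1 : R) (fun s => a i s *: f i s)
    ('D_1 (a i) t *: f i t + a i t *: 'D_1 (f i) t).
  split; last exact: derive_scale (da i) (df i).
  exact/diff_derivable/(differentiable_scale (da i) (df i)).
have -> : (fun s => \sum_i a i s *: f i s) = \sum_i (fun s => a i s *: f i s).
  by apply/funext => s; rewrite fct_sumE.
suff [] : is_derive t (1 : R) (\sum_i (fun s => a i s *: f i s))
    (\sum_i ('D_1 (a i) t *: f i t + a i t *: 'D_1 (f i) t)) by [].
elim: (index_enum I) => [|i s IH]; first by rewrite !big_nil; exact: is_derive_cst.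
by rewrite !big_cons; exact: is_deriveD.
Qed.

End DirectionalDerivative.

Section GroupSmooth.
Context {R : realType} {d : nat} {G : lieGroupType R d}.
Implicit Types (V W : normedModType R) (phi psi chi : chart R d G).

Lemma chart_dom_nbhs phi x : chart_dom phi x -> nbhs x (chart_dom phi).
Proof. by move=> dx; apply: open_nbhs_nbhs; split => //; exact: chart_dom_open. Qed.

Lemma chart_img_nbhs phi x :
  chart_dom phi x -> nbhs (phi x) (phi @` chart_dom phi).
Proof.
move=> dx; apply: open_nbhs_nbhs; split; first exact: chart_img_open.
by exists x.
Qed.

Lemma chart_inv_cts phi u : (phi @` chart_dom phi) u ->
  {for u, continuous (chart_inv phi)}.
Proof. by move=> du; apply: (@chart_inv_continuous _ _ _ phi); rewrite inE. Qed.

Lemma chart_invP phi u : (phi @` chart_dom phi) u ->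
  chart_dom phi (chart_inv phi u) /\ phi (chart_inv phi u) = u.
Proof. by move=> [x dx <-]; rewrite chartK. Qed.

(** Continuity is included because it keeps nearby values inside the chart domain, where [phi \o f]
    is meaningful. *)
Definition gsmooth V (f : V -> G) (x : V) : Prop :=
  {for x, continuous f} /\
  forall phi, lie_atlas phi -> chart_dom phi (f x) -> smooth_at (phi \o f) x.

(** A single chart decides, since the transition maps to the others are smooth. *)
Lemma gsmooth_chart V (f : V -> G) x phi : lie_atlas phi ->
  chart_dom phi (f x) -> {for x, continuous f} -> smooth_at (phi \o f) x ->
  gsmooth f x.
Proof.
move=> aphi dphi cf sf; split=> // psi apsi dpsi.
have st : smooth_at (fun u => psi (chart_inv phi u)) (phi (f x)).
  apply: smooth_at_on (lie_atlas_compat _ _ aphi apsi).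
  have h : \forall u \near phi (f x), chart_dom psi (chart_inv phi u).
    apply: (chart_inv_cts (phi := phi)); first by exists (f x).
    by rewrite chartK//; exact: chart_dom_nbhs.
  apply: filterS2 h (chart_img_nbhs dphi) => u du [y dy yu].
  by rewrite -yu chartK// in du; exists y.
have := smooth_at_comp (finite_coordinates_rV d) sf st.
apply: near_eq_smooth_at.
have nf : \forall y \near x, chart_dom phi (f y) by apply: cf; exact: chart_dom_nbhs.
by apply: filterS nf => y dy /=; rewrite chartK.
Qed.

(** Continuity is given at [x] only; at a nearby point it is recovered from
    [f = chart_inv phi \o (phi \o f)], which holds around that point. *)
Lemma gsmooth_near V (f : V -> G) x :
  gsmooth f x -> \forall y \near x, gsmooth f y.
Proof.
move=> [cf sf]; have [phi aphi dphi] := lie_atlas_cover (f x).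
have nf : \forall y \near x, chart_dom phi (f y) by apply: cf; exact: chart_dom_nbhs.
apply: filterS2 (near_join nf) (smooth_at_near (sf _ aphi dphi)) => y dy sy.
have dfy := nbhs_singleton dy.
apply: (gsmooth_chart aphi) => //.
have /(smooth_at_continuous) cy := sy.
have c : {for y, continuous (chart_inv phi \o (phi \o f))}.
  by apply: continuous_comp => //; apply: chart_inv_cts; exists (f y).
have H : (chart_inv phi \o (phi \o f)) @ y --> f y.
  by rewrite -[X in _ --> X](chartK dfy); exact: c.
apply: cvg_trans H; apply: near_eq_cvg.
by apply: filterS dy => z dz /=; rewrite chartK.
Qed.

Lemma gsmooth_cst V (g : G) (x : V) : gsmooth (cst g) x.
Proof.
split; first exact: cst_continuous.
by move=> phi _ _; apply: (smooth_at_cst (phi g)).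
Qed.

Lemma gsmooth_comp V W (f : V -> G) (g : W -> V) x : finite_coordinates V ->
  smooth_at g x -> gsmooth f (g x) -> gsmooth (f \o g) x.
Proof.
move=> fV sg [cf sf]; split.
  by apply: continuous_comp => //; exact: smooth_at_continuous.
by move=> phi aphi dphi; apply: (smooth_at_comp (f := phi \o f) fV sg); exact: sf.
Qed.

Lemma gsmooth_chart_inv V (u : V -> 'rV[R]_d) x phi : lie_atlas phi ->
  smooth_at u x -> (phi @` chart_dom phi) (u x) ->
  gsmooth (chart_inv phi \o u) x.
Proof.
move=> aphi su dux; have [dx px] := chart_invP dux.
have cu := smooth_at_continuous su.
apply: (gsmooth_chart aphi) => //.
  by apply: continuous_comp => //; exact: chart_inv_cts.
apply: near_eq_smooth_at su.
have : \forall y \near x, (phi @` chart_dom phi) (u y).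
  apply: cu; apply: open_nbhs_nbhs; split => //; exact: chart_img_open.
by apply: filterS => y /chart_invP[_ /= ->].
Qed.

Lemma gsmooth_mul V (f g : V -> G) x : gsmooth f x -> gsmooth g x ->
  gsmooth (fun y => f y * g y)%g x.
Proof.
move=> [cf sf] [cg sg]; split.
  apply: (@continuous_comp _ _ _ (fun y => (f y, g y)) (fun p => p.1 * p.2)%g).
    exact: cvg_pair.
  exact: lie_mul_continuous.
move=> chi achi dchi.
have [phi aphi dphi] := lie_atlas_cover (f x).
have [psi apsi dpsi] := lie_atlas_cover (g x).
have sp := smooth_at_pair (sf _ aphi dphi) (sg _ apsi dpsi).
set m := fun p : 'rV_d * 'rV_d => chi (chart_inv phi p.1 * chart_inv psi p.2)%g.
have sm : smooth_at m (phi (f x), psi (g x)).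
  apply: smooth_at_on (lie_mul_smooth _ _ _ aphi apsi achi).
  have h1 : \forall p \near (phi (f x), psi (g x)), (phi @` chart_dom phi) p.1.
    by apply: cvg_fst; exact: chart_img_nbhs.
  have h2 : \forall p \near (phi (f x), psi (g x)), (psi @` chart_dom psi) p.2.
    by apply: cvg_snd; exact: chart_img_nbhs.
  have h3 : \forall p \near (phi (f x), psi (g x)),
      chart_dom chi (chart_inv phi p.1 * chart_inv psi p.2)%g.
    have cm : {for (phi (f x), psi (g x)), continuous
       ((fun q : G * G => (q.1 * q.2)%g) \o
        (fun p => (chart_inv phi p.1, chart_inv psi p.2)))}.
      apply: continuous_comp; last exact: lie_mul_continuous.
      apply: cvg_pair => /=.
        apply: (cvg_comp fst (chart_inv phi)); first exact: cvg_fst.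
        by apply: (chart_inv_cts (phi := phi)); exists (f x).
      apply: (cvg_comp snd (chart_inv psi)); first exact: cvg_snd.
      by apply: (chart_inv_cts (phi := psi)); exists (g x).
    by apply: cm; rewrite /= !chartK//; exact: chart_dom_nbhs.
  by near=> p; split; near: p.
have := smooth_at_comp (finite_coordinates_prod (finite_coordinates_rV d)
  (finite_coordinates_rV d)) sp sm.
apply: near_eq_smooth_at.
have nf : \forall y \near x, chart_dom phi (f y) by apply: cf; exact: chart_dom_nbhs.
have ng : \forall y \near x, chart_dom psi (g y) by apply: cg; exact: chart_dom_nbhs.
by apply: filterS2 nf ng => y df dg /=; rewrite /m /= !chartK.
Unshelve. all: by end_near. Qed.

Lemma gsmooth_invg V (f : V -> G) x : gsmooth f x ->
  gsmooth (fun y => (f y)^-1)%g x.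
Proof.
move=> [cf sf]; split.
  apply: (@continuous_comp _ _ _ f (fun p => p^-1)%g) => //.
  exact: lie_inv_continuous.
move=> chi achi dchi.
have [phi aphi dphi] := lie_atlas_cover (f x).
set m := fun u => chi (chart_inv phi u)^-1%g.
have sm : smooth_at m (phi (f x)).
  apply: smooth_at_on (lie_inv_smooth _ _ aphi achi).
  have h3 : \forall u \near phi (f x), chart_dom chi (chart_inv phi u)^-1%g.
    have cm : {for phi (f x), continuous
       ((fun q : G => (q^-1)%g) \o chart_inv phi)}.
      apply: continuous_comp; last exact: lie_inv_continuous.
      by apply: chart_inv_cts; exists (f x).
    by apply: cm; rewrite /= !chartK//; exact: chart_dom_nbhs.
  by apply: filterS2 h3 (chart_img_nbhs dphi) => u.
have := smooth_at_comp (finite_coordinates_rV d) (sf _ aphi dphi) sm.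
apply: near_eq_smooth_at.
have nf : \forall y \near x, chart_dom phi (f y) by apply: cf; exact: chart_dom_nbhs.
by apply: filterS nf => y df /=; rewrite /m /= !chartK.
Qed.

(** Smoothness at 0 spreads to a neighbourhood by [gsmooth_near], so the pointwise notion can stand
    for the definition from here on. *)
Lemma smooth_near0P (c : R -> G) : smooth_near0 c <-> gsmooth c 0.
Proof.
split=> [[U [oU U0] [cc sc]]|sc].
  have [phi aphi dphi] := lie_atlas_cover (c 0).
  have c0 : {for (0:R), continuous c} by apply: cc; rewrite inE.
  apply: (gsmooth_chart aphi dphi) => //.
  apply: smooth_at_on (sc _ aphi); apply: filterI; first exact: open_nbhs_nbhs.
  by apply: c0; exact: chart_dom_nbhs.
have : \forall t \near (0 : R), gsmooth c t by exact: gsmooth_near.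
rewrite /prop_near1 nbhsE => -[U [oU U0] US]; exists U; first by [].
split=> [t|phi aphi vs t [/US[_ sct] dt]]; first by rewrite inE => /US[].
by have [B [_ Bt] +] := sct _ aphi dt; exact.
Qed.

End GroupSmooth.

(** * The adjoint action and the logarithmic derivative *)

Section Adjoint.
Context {R : realType} {d : nat} {G : lieGroupType R d}.
Variable phi : chart R d G.
Hypotheses (phi_atlas : lie_atlas phi) (phi_one : chart_dom phi 1%g).
Implicit Types V W : normedModType R.

Local Notation e1 := (phi 1%g).
Local Notation vec := 'rV[R]_d.
Let frV : finite_coordinates vec := finite_coordinates_rV d.
Let frV2 : finite_coordinates (vec * vec)%type :=
  finite_coordinates_prod frV frV.

Lemma e1_img : (phi @` chart_dom phi) e1.
Proof. by exists 1%g. Qed.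

Lemma near_e1_img : \forall u \near e1, (phi @` chart_dom phi) u.
Proof. exact: chart_img_nbhs. Qed.

Lemma chart_inv_e1 : chart_inv phi e1 = 1%g.
Proof. exact: chartK. Qed.

Lemma gsmooth_near_dom V (f : V -> G) x : gsmooth f x -> chart_dom phi (f x) ->
  \forall y \near x, chart_dom phi (f y).
Proof. by move=> [cf _] dfx; apply: cf; exact: chart_dom_nbhs. Qed.

Lemma gsmooth_smooth V (f : V -> G) x : gsmooth f x -> chart_dom phi (f x) ->
  smooth_at (fun y => phi (f y)) x.
Proof. by move=> [_ sf] dfx; exact: sf. Qed.

Lemma gsmooth_inv_at V (u : V -> vec) x : smooth_at u x ->
  (phi @` chart_dom phi) (u x) -> gsmooth (fun y => chart_inv phi (u y)) x.
Proof. by move=> su; exact: gsmooth_chart_inv. Qed.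

Definition conj_chart (g : G) (u : vec) : vec :=
  phi (g * chart_inv phi u * g^-1)%g.

Lemma conj_chart1 g : conj_chart g e1 = e1.
Proof. by rewrite /conj_chart chart_inv_e1 mulg1 mulgV. Qed.

Lemma gsmooth_conj g : gsmooth (fun u => g * chart_inv phi u * g^-1)%g e1.
Proof.
apply: gsmooth_mul; last exact: gsmooth_cst.
apply: gsmooth_mul; first exact: gsmooth_cst.
by apply: gsmooth_inv_at e1_img; exact: smooth_at_id.
Qed.

Lemma smooth_conj g : smooth_at (conj_chart g) e1.
Proof.
by apply: (gsmooth_smooth (gsmooth_conj g)); rewrite chart_inv_e1 mulg1 mulgV.
Qed.

Lemma AdE g y : Ad phi g y = 'D_y (conj_chart g) e1.
Proof. by []. Qed.

Lemma AdD g y z : Ad phi g (y + z) = Ad phi g y + Ad phi g z.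
Proof.
by rewrite !AdE deriveDv//; exact/smooth_at_differentiable/smooth_conj.
Qed.

Lemma AdZ g a y : Ad phi g (a *: y) = a *: Ad phi g y.
Proof.
by rewrite !AdE deriveZv//; exact/smooth_at_differentiable/smooth_conj.
Qed.

Lemma Ad_sum g (I : finType) (a : I -> R) (e : I -> vec) :
  Ad phi g (\sum_i a i *: e i) = \sum_i a i *: Ad phi g (e i).
Proof.
by rewrite !AdE derive_sumv//; exact/smooth_at_differentiable/smooth_conj.
Qed.

(** [Ad] is defined along straight lines of the chart; the chain rule extends it to the velocity of
    any smooth curve passing through the unit. *)
Lemma Ad_velocity g (e : R -> G) t : gsmooth e t -> e t = 1%g ->
  'D_1 (fun s => phi (g * e s * g^-1)%g) t = Ad phi g ('D_1 (phi \o e) t).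
Proof.
move=> se et; have det : chart_dom phi (e t) by rewrite et.
have du := smooth_at_differentiable (gsmooth_smooth se det).
have dc : differentiable (conj_chart g) (phi (e t)).
  by rewrite et; exact/smooth_at_differentiable/smooth_conj.
rewrite AdE -et -[RHS](derive_curve du dc).
apply: near_eq_derive; apply: filterS (gsmooth_near_dom se det) => s ds /=.
by rewrite /conj_chart chartK.
Qed.

(** Conjugations compose and fix the unit, so this is the chain rule at the fixed point [e1]. *)
Lemma AdM g h y : Ad phi (g * h)%g y = Ad phi g (Ad phi h y).
Proof.
have dh := smooth_at_differentiable (smooth_conj h).
have dg : differentiable (conj_chart g) (conj_chart h e1).
  by rewrite conj_chart1; exact/smooth_at_differentiable/smooth_conj.
rewrite !AdE -[in X in _ = 'D__ _ X](conj_chart1 h) -(derive_comp y dh dg).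
apply: near_eq_derive.
have : \forall u \near e1, chart_dom phi (h * chart_inv phi u * h^-1)%g.
  apply: gsmooth_near_dom (gsmooth_conj h) _.
  by rewrite chart_inv_e1 mulg1 mulgV.
apply: filterS => u du /=; rewrite /conj_chart chartK// invgM.
by rewrite !mulgA.
Qed.

Lemma Ad1 y : Ad phi 1%g y = y.
Proof.
rewrite AdE -[RHS](derive_id e1 y); apply: near_eq_derive.
apply: filterS near_e1_img => u /chart_invP[_ pu].
by rewrite /conj_chart mul1g invg1 mulg1 pu.
Qed.

Lemma AdVK g y : Ad phi g^-1%g (Ad phi g y) = y.
Proof. by rewrite -AdM mulVg Ad1. Qed.

(** Conjugation is smooth in both arguments jointly, as the map [K]; the function in question is its
    partial derivative at [(u, e1)] in the direction [(0, w)]. *)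
Lemma smooth_Ad_inv w : smooth_at (fun u => Ad phi (chart_inv phi u) w) e1.
Proof.
pose K (q : vec * vec) :=
  phi (chart_inv phi q.1 * chart_inv phi q.2 * (chart_inv phi q.1)^-1)%g.
have sK : smooth_at K (e1, e1).
  apply: (@gsmooth_smooth _ (fun q : vec * vec =>
    chart_inv phi q.1 * chart_inv phi q.2 * (chart_inv phi q.1)^-1)%g).
    have s1 : gsmooth (fun q : vec * vec => chart_inv phi q.1) (e1, e1).
      by apply: gsmooth_inv_at e1_img; exact: smooth_at_fst.
    apply: gsmooth_mul; last exact: gsmooth_invg.
    apply: gsmooth_mul => //.
    by apply: gsmooth_inv_at e1_img; exact: smooth_at_snd.
  by rewrite /= chart_inv_e1 mulg1 mulgV.
have sh : smooth_at (fun u : vec => (u, e1)) e1.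
  by apply: smooth_at_pair; [exact: smooth_at_id|exact: smooth_at_cst].
have := smooth_at_dirderive frV2 sh (smooth_at_cst (0, w) e1) sK.
apply: near_eq_smooth_at.
have : \forall u \near e1, smooth_at K (u, e1).
  exact: (smooth_at_continuous sh) (smooth_at_near sK).
apply: filterS => u /smooth_at_differentiable dK.
by rewrite [LHS](derive_pairr _ dK).
Qed.

Lemma adE x w : ad phi x w = 'D_x (fun u => Ad phi (chart_inv phi u) w) e1.
Proof. by []. Qed.

Lemma ad_suml (I : finType) (a : I -> R) (e : I -> vec) w :
  ad phi (\sum_i a i *: e i) w = \sum_i a i *: ad phi (e i) w.
Proof.
by rewrite !adE derive_sumv//; exact/smooth_at_differentiable/smooth_Ad_inv.
Qed.

Lemma adDr x w z : ad phi x (w + z) = ad phi x w + ad phi x z.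
Proof.
rewrite !adE -deriveD; first by apply: near_eq_derive; near=> u; exact: AdD.
- exact/diff_derivable/smooth_at_differentiable/smooth_Ad_inv.
- exact/diff_derivable/smooth_at_differentiable/smooth_Ad_inv.
Unshelve. all: by end_near. Qed.

Lemma adZr x a w : ad phi x (a *: w) = a *: ad phi x w.
Proof.
rewrite !adE -deriveZ; first by apply: near_eq_derive; near=> u; exact: AdZ.
exact/diff_derivable/smooth_at_differentiable/smooth_Ad_inv.
Unshelve. all: by end_near. Qed.

Lemma ad0r x : ad phi x 0 = 0.
Proof. by rewrite -[X in ad _ _ X](scale0r 0) adZr scale0r. Qed.

Lemma ad_sumr (I : finType) (a : I -> R) (e : I -> vec) x :
  ad phi x (\sum_i a i *: e i) = \sum_i a i *: ad phi x (e i).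
Proof.
elim/big_rec2: _ => [|i y1 y2 _ <-]; first exact: ad0r.
by rewrite adDr adZr.
Qed.

Lemma right_log_deriveE (c : R -> G) t :
  right_log_derive phi c t = 'D_1 (phi \o (fun s => c s * (c t)^-1)%g) t.
Proof. by rewrite /right_log_derive derive1E. Qed.

Lemma gsmooth_mulr (c : R -> G) t g : gsmooth c t ->
  gsmooth (fun s => c s * g)%g t.
Proof. by move=> sc; apply: gsmooth_mul => //; exact: gsmooth_cst. Qed.

(** [smooth_Ad_inv] covers only the unit. Writing [Ad (c s) v] as [Ad (c s * (c t)^-1)] applied to
    [Ad (c t) v] moves the base point there; the same shift makes the logarithmic derivative appear
    in [derive_Ad_curve]. *)
Lemma smooth_Ad_curve (c : R -> G) t v : gsmooth c t ->
  smooth_at (fun s => Ad phi (c s) v) t.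
Proof.
move=> sc; have se := gsmooth_mulr (c t)^-1%g sc.
have dt : chart_dom phi (c t * (c t)^-1)%g by rewrite mulgV.
have su := gsmooth_smooth se dt.
have sA := smooth_Ad_inv (Ad phi (c t) v).
rewrite -[e1](congr1 phi (mulgV (c t))) in sA.
apply: near_eq_smooth_at (smooth_at_comp frV su sA).
apply: filterS (gsmooth_near_dom se dt) => s ds /=.
by rewrite (chartK ds) -AdM mulgVK.
Qed.

Lemma derive_Ad_curve (c : R -> G) t v : gsmooth c t ->
  'D_1 (fun s => Ad phi (c s) v) t =
  ad phi (right_log_derive phi c t) (Ad phi (c t) v).
Proof.
move=> sc; have se := gsmooth_mulr (c t)^-1%g sc.
have dt : chart_dom phi (c t * (c t)^-1)%g by rewrite mulgV.
have du := smooth_at_differentiable (gsmooth_smooth se dt).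
have dA := smooth_at_differentiable (smooth_Ad_inv (Ad phi (c t) v)).
rewrite adE right_log_deriveE.
rewrite -[e1](congr1 phi (mulgV (c t))) in dA *.
rewrite -(derive_curve du dA); apply: near_eq_derive.
apply: filterS (gsmooth_near_dom se dt) => s ds /=.
by rewrite (chartK ds) -AdM mulgVK.
Qed.

(** By linearity, coordinates of [v s] separate the two dependences on [s] into scalars times curves
    with a fixed vector. The rules for [ad] with two moving arguments follow the same pattern. *)
Lemma smooth_Ad (c : R -> G) (v : R -> vec) t : gsmooth c t -> smooth_at v t ->
  smooth_at (fun s => Ad phi (c s) (v s)) t.
Proof.
move=> sc sv; have [I [e [k [ck ke]]]] := frV.
have -> : (fun s => Ad phi (c s) (v s)) =
    fun s => \sum_i (k i \o v) s *: Ad phi (c s) (e i).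
  by apply/funext => s; rewrite {1}(ke (v s)) Ad_sum.
apply: smooth_at_sum => i; apply: smooth_atZ; last exact: smooth_Ad_curve.
exact: smooth_at_lin_comp.
Qed.

Lemma derive_Ad (c : R -> G) (v : R -> vec) t : gsmooth c t -> smooth_at v t ->
  derive1 (fun s => Ad phi (c s) (v s)) t =
  Ad phi (c t) (derive1 v t) +
  ad phi (right_log_derive phi c t) (Ad phi (c t) (v t)).
Proof.
move=> sc sv; have [I [e [k [ck ke]]]] := frV.
have -> : (fun s => Ad phi (c s) (v s)) =
    fun s => \sum_i (k i \o v) s *: Ad phi (c s) (e i).
  by apply/funext => s; rewrite {1}(ke (v s)) Ad_sum.
have dv := smooth_at_differentiable sv.
have dA i := smooth_at_differentiable (smooth_Ad_curve (e i) sc).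
have dk i : differentiable (k i) (v t) by exact: linear_differentiable.
have dkv i : differentiable (k i \o v) t by exact: differentiable_comp.
rewrite (derive1_sum_scale dkv dA) derive1E.
rewrite [in X in _ = Ad _ _ X + _](ke ('D_1 v t)).
rewrite [in X in _ = _ + ad _ _ (Ad _ _ X)](ke (v t)).
rewrite !Ad_sum ad_sumr -big_split; apply: eq_bigr => i _.
rewrite (derive_curve dv (dk i)) (derive_lin _ _ (ck i)).
by rewrite (derive_Ad_curve _ sc).
Qed.

Lemma smooth_adl (x : R -> vec) w t : smooth_at x t ->
  smooth_at (fun s => ad phi (x s) w) t.
Proof.
move=> sx; have [I [e [k [ck ke]]]] := frV.
have -> : (fun s => ad phi (x s) w) =
    fun s => \sum_i (k i \o x) s *: ad phi (e i) w.
  by apply/funext => s; rewrite {1}(ke (x s)) ad_suml.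
apply: smooth_at_sum => i; apply: smooth_atZ; first exact: smooth_at_lin_comp.
exact: smooth_at_cst.
Qed.

Lemma derive_adl (x : R -> vec) w t : smooth_at x t ->
  'D_1 (fun s => ad phi (x s) w) t = ad phi (derive1 x t) w.
Proof.
move=> sx; have [I [e [k [ck ke]]]] := frV.
have -> : (fun s => ad phi (x s) w) =
    fun s => \sum_i (k i \o x) s *: (fun=> ad phi (e i) w) s.
  by apply/funext => s; rewrite {1}(ke (x s)) ad_suml.
have dx := smooth_at_differentiable sx.
have dk i : differentiable (k i) (x t) by exact: linear_differentiable.
have dkx i : differentiable (k i \o x) t by exact: differentiable_comp.
have dc i : differentiable (fun _ : R => ad phi (e i) w) t.
  exact: differentiable_cst.
rewrite -derive1E (derive1_sum_scale dkx dc) derive1E (ke ('D_1 x t)) ad_suml.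
apply: eq_bigr => i _; rewrite (derive_curve dx (dk i)) (derive_lin _ _ (ck i)).
by rewrite (derive_cst (ad phi (e i) w)) scaler0 addr0.
Qed.

Lemma smooth_ad (x y : R -> vec) t : smooth_at x t -> smooth_at y t ->
  smooth_at (fun s => ad phi (x s) (y s)) t.
Proof.
move=> sx sy; have [I [e [k [ck ke]]]] := frV.
have -> : (fun s => ad phi (x s) (y s)) =
    fun s => \sum_i (k i \o y) s *: ad phi (x s) (e i).
  by apply/funext => s; rewrite {1}(ke (y s)) ad_sumr.
apply: smooth_at_sum => i; apply: smooth_atZ; last exact: smooth_adl.
exact: smooth_at_lin_comp.
Qed.

Lemma derive_ad (x y : R -> vec) t : smooth_at x t -> smooth_at y t ->
  derive1 (fun s => ad phi (x s) (y s)) t =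
  ad phi (derive1 x t) (y t) + ad phi (x t) (derive1 y t).
Proof.
move=> sx sy; have [I [e [k [ck ke]]]] := frV.
have -> : (fun s => ad phi (x s) (y s)) =
    fun s => \sum_i (k i \o y) s *: ad phi (x s) (e i).
  by apply/funext => s; rewrite {1}(ke (y s)) ad_sumr.
have dy := smooth_at_differentiable sy.
have da i := smooth_at_differentiable (smooth_adl (e i) sx).
have dk i : differentiable (k i) (y t) by exact: linear_differentiable.
have dky i : differentiable (k i \o y) t by exact: differentiable_comp.
rewrite (derive1_sum_scale dky da) (derive1E y).
rewrite [in X in _ = ad _ _ X + _](ke (y t)).
rewrite [in X in _ = _ + ad _ _ X](ke ('D_1 y t)).
rewrite !ad_sumr -big_split; apply: eq_bigr => i _.
rewrite (derive_curve dy (dk i)) (derive_lin _ _ (ck i)).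
by rewrite (derive_adl _ sx) addrC.
Qed.

End Adjoint.

(** * Logarithmic derivatives of products and inverses, and in a chart *)

Section LogDerivative.
Context {R : realType} {d : nat} {G : lieGroupType R d}.
Variable phi : chart R d G.
Hypotheses (phi_atlas : lie_atlas phi) (phi_one : chart_dom phi 1%g).
Implicit Types (c b : R -> G) (t : R).

Local Notation e1 := (phi 1%g).
Local Notation vec := 'rV[R]_d.
Local Notation delta := (right_log_derive phi).
Let frR2 : finite_coordinates (R * R)%type :=
  finite_coordinates_prod finite_coordinatesR finite_coordinatesR.
Let frV : finite_coordinates vec := finite_coordinates_rV d.
Let frV2 : finite_coordinates (vec * vec)%type :=
  finite_coordinates_prod frV frV.

Lemma gsmooth_fst c (q : R * R) : gsmooth c q.1 ->
  gsmooth (fun r : R * R => c r.1) q.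
Proof. exact: gsmooth_comp finite_coordinatesR (smooth_at_fst q). Qed.

Lemma gsmooth_snd c (q : R * R) : gsmooth c q.2 ->
  gsmooth (fun r : R * R => c r.2) q.
Proof. exact: gsmooth_comp finite_coordinatesR (smooth_at_snd q). Qed.

(** The time enters twice, as the point of differentiation and in the translation by the inverse.
    With separate times this is the partial derivative of [H] on the diagonal. *)
Lemma smooth_right_log_derive c t : gsmooth c t -> smooth_at (delta c) t.
Proof.
move=> sc; pose H (q : R * R) := phi (c q.1 * (c q.2)^-1)%g.
have sH r : gsmooth c r -> smooth_at H (r, r).
  move=> sr; apply: (gsmooth_smooth phi_atlas); last by rewrite mulgV.
  by apply: gsmooth_mul; [exact: gsmooth_fst|exact/gsmooth_invg/gsmooth_snd].
have sdiag : smooth_at (fun r : R => (r, r)) t.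
  by apply: smooth_at_pair; exact: smooth_at_id.
have sv := smooth_at_cst (1 : R, 0 : R) t.
have := smooth_at_dirderive frR2 sdiag sv (sH _ sc).
apply: near_eq_smooth_at; apply: filterS (gsmooth_near sc) => r /sH.
move=> /smooth_at_differentiable dH.
by rewrite right_log_deriveE; exact: derive_pairl dH.
Qed.

Lemma right_log_deriveM c b t : gsmooth c t -> gsmooth b t ->
  delta (fun s => c s * b s)%g t = delta c t + Ad phi (c t) (delta b t).
Proof.
move=> sc sb.
(* Inserting [(c t)^-1 * c t] separates the motions of [c] and [b]. With one time for each, the
   derivative along the diagonal is the sum of two partial derivatives, the second of which involves
   conjugation by [c t]. *)
pose Q (q : R * R) :=
  phi ((c q.1 * (c t)^-1) * (c t * (b q.2 * (b t)^-1) * (c t)^-1))%g.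
have sQ : smooth_at Q (t, t).
  apply: (gsmooth_smooth phi_atlas); last by rewrite /= !mulgV mulg1 mulgV mulg1.
  do !apply: gsmooth_mul; try exact: gsmooth_cst.
    exact: gsmooth_fst.
  exact: gsmooth_snd.
have dQ := smooth_at_differentiable sQ.
have di : differentiable (id : R -> R) t by [].
have dd := differentiable_pair di di.
have e : 'D_1 (fun r : R => (r, r)) t = (1, 0) + (0, 1).
  have := derive_pair_curve di di; rewrite derive_id => ->.
  by congr pair; rewrite /= ?addr0 ?add0r.
have EQ : phi \o (fun s => c s * b s * (c t * b t)^-1)%g =
    Q \o (fun r : R => (r, r)).
  by apply/funext => s /=; rewrite /Q /= invgM !mulgA mulgVK.
have Ec : (fun s => Q (s, t)) = phi \o (fun s => c s * (c t)^-1)%g.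
  by apply/funext => s; rewrite /Q /= !mulgV mulg1 mulgV mulg1.
have Eb : (fun s => Q (t, s)) =
    fun s => phi (c t * (b s * (b t)^-1) * (c t)^-1)%g.
  by apply/funext => s; rewrite /Q /= mulgV mul1g.
rewrite right_log_deriveE EQ (derive_curve dd dQ) e (deriveDv _ _ dQ).
rewrite (derive_pairl _ dQ) (derive_pairr _ dQ) Ec Eb -right_log_deriveE.
congr (_ + _); rewrite (right_log_deriveE phi b).
by rewrite -(Ad_velocity phi_atlas phi_one _ (gsmooth_mulr _ sb) (mulgV (b t))).
Qed.

Lemma right_log_derive_cst g t : delta (fun=> g) t = 0.
Proof.
rewrite right_log_deriveE.
have -> : phi \o (fun s : R => g * g^-1)%g = cst (phi (g * g^-1)%g) by [].
exact: derive_cst.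
Qed.

(** The product rule is applied to the constant curve [(c s)^-1 * c s]. *)
Lemma right_log_deriveV c t : gsmooth c t ->
  delta (fun s => (c s)^-1)%g t = - Ad phi (c t)^-1%g (delta c t).
Proof.
move=> sc; apply/eqP; rewrite -addr_eq0; apply/eqP.
rewrite -right_log_deriveM//; last exact: gsmooth_invg.
have -> : (fun s => (c s)^-1 * c s)%g = (fun=> 1%g).
  by apply/funext => s; rewrite mulVg.
exact: right_log_derive_cst.
Qed.

Lemma AdKV g y : Ad phi g (Ad phi g^-1%g y) = y.
Proof. by rewrite -AdM// mulgV Ad1. Qed.

Lemma derive_AdV c (v : R -> vec) t : gsmooth c t -> smooth_at v t ->
  derive1 (fun s => Ad phi (c s)^-1%g (v s)) t =
  Ad phi (c t)^-1%g (derive1 v t - ad phi (delta c t) (v t)).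
Proof.
move=> sc sv; pose w s := Ad phi (c s)^-1%g (v s).
have sw : smooth_at w t by apply: smooth_Ad => //; exact: gsmooth_invg.
have ew s : Ad phi (c s) (w s) = v s by rewrite /w AdKV.
have ev : (fun s => Ad phi (c s) (w s)) = v by apply/funext.
have := derive_Ad phi_atlas phi_one sc sw; rewrite ev ew => ->.
by rewrite addrK (AdVK phi_atlas phi_one).
Qed.

Definition right_chart c (g : G) t : vec := phi (c t * g^-1)%g.

Definition divg_chart (p : vec * vec) : vec :=
  phi (chart_inv phi p.1 * (chart_inv phi p.2)^-1)%g.

Definition mulg_chart (p : vec * vec) : vec :=
  phi (chart_inv phi p.1 * chart_inv phi p.2)%g.

(** Expresses [delta c] through position and velocity in the chart: the denominator of the quotient
    stays at [u] while the numerator moves with velocity [u']. *)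
Definition logder_map (q : vec * vec) : vec :=
  'D_(q.2, 0) divg_chart (q.1, q.1).

(** In the chart, the value at [q.1] of the right-invariant vector field that equals [q.2] at the
    unit. *)
Definition velocity_map (q : vec * vec) : vec :=
  'D_(q.2, 0) mulg_chart (e1, q.1).

Lemma smooth_divg_chart u : (phi @` chart_dom phi) u ->
  smooth_at divg_chart (u, u).
Proof.
move=> du; apply: (gsmooth_smooth phi_atlas); last by rewrite /= mulgV.
apply: gsmooth_mul; last apply: gsmooth_invg.
  by apply: gsmooth_inv_at => //; exact: smooth_at_fst.
by apply: gsmooth_inv_at => //; exact: smooth_at_snd.
Qed.

Lemma smooth_mulg_chart u : (phi @` chart_dom phi) u ->
  smooth_at mulg_chart (e1, u).
Proof.
move=> du; apply: (gsmooth_smooth phi_atlas).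
  apply: gsmooth_mul.
    by apply: gsmooth_inv_at => //; [exact: smooth_at_fst|exact: e1_img].
  by apply: gsmooth_inv_at => //; exact: smooth_at_snd.
by rewrite /= chart_inv_e1// mul1g; have [] := chart_invP du.
Qed.

Lemma smooth_logder_map q :
  (phi @` chart_dom phi) q.1 -> smooth_at logder_map q.
Proof.
move=> dq; apply: (smooth_at_dirderive (K := divg_chart)
  (h := fun q : vec * vec => (q.1, q.1)) (l := fun q : vec * vec => (q.2, 0))
  frV2).
- by apply: smooth_at_pair; exact: smooth_at_fst.
- by apply: smooth_at_pair; [exact: smooth_at_snd|exact: smooth_at_cst].
- exact: smooth_divg_chart.
Qed.

Lemma smooth_velocity_map q :
  (phi @` chart_dom phi) q.1 -> smooth_at velocity_map q.
Proof.
move=> dq; apply: (smooth_at_dirderive (K := mulg_chart)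
  (h := fun q : vec * vec => (e1, q.1)) (l := fun q : vec * vec => (q.2, 0))
  frV2).
- by apply: smooth_at_pair; [exact: smooth_at_cst|exact: smooth_at_fst].
- by apply: smooth_at_pair; [exact: smooth_at_snd|exact: smooth_at_cst].
- exact: smooth_mulg_chart.
Qed.

Lemma smooth_right_chart c g t : gsmooth c t -> chart_dom phi (c t * g^-1)%g ->
  smooth_at (right_chart c g) t.
Proof. by move=> sc; apply: gsmooth_smooth; [|exact: gsmooth_mulr]. Qed.

(** The translation by [g^-1] cancels in the quotient [c s * (c t)^-1]. *)
Lemma right_log_derive_chart c g t : gsmooth c t ->
  chart_dom phi (c t * g^-1)%g ->
  delta c t = logder_map (right_chart c g t, derive1 (right_chart c g) t).
Proof.
move=> sc dt; have sgc := gsmooth_mulr g^-1%g sc.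
have dimg : (phi @` chart_dom phi) (right_chart c g t) by exists (c t * g^-1)%g.
have du := smooth_at_differentiable (smooth_right_chart sc dt).
have dK := smooth_at_differentiable (smooth_divg_chart dimg).
have dc : differentiable (cst (right_chart c g t)) t by [].
have dp := differentiable_pair du dc.
rewrite /logder_map /= derive1E.
have e : 'D_1 (fun s => (right_chart c g s, right_chart c g t)) t =
    ('D_1 (right_chart c g) t, 0).
  by have := derive_pair_curve du dc; rewrite derive_cst.
rewrite -e -(derive_curve dp dK) right_log_deriveE; apply: near_eq_derive.
apply: filterS (gsmooth_near_dom sgc dt) => s ds /=.
by rewrite /divg_chart /right_chart /= !chartK// invgM invgK mulgA mulgVK.
Qed.

Lemma right_chart_derive c g t : gsmooth c t ->
  chart_dom phi (c t * g^-1)%g ->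
  derive1 (right_chart c g) t = velocity_map (right_chart c g t, delta c t).
Proof.
move=> sc dt; have sgc := gsmooth_mulr (c t)^-1%g sc.
have dimg : (phi @` chart_dom phi) (right_chart c g t) by exists (c t * g^-1)%g.
have det : chart_dom phi (c t * (c t)^-1)%g by rewrite mulgV.
have du := smooth_at_differentiable (gsmooth_smooth phi_atlas sgc det).
have dK := smooth_at_differentiable (smooth_mulg_chart dimg).
have dc : differentiable (cst (right_chart c g t)) t by [].
have dp := differentiable_pair du dc.
rewrite /velocity_map /= derive1E right_log_deriveE.
have e := derive_pair_curve du dc; rewrite derive_cst in e.
rewrite -e.
have E : (e1, right_chart c g t) = (phi (c t * (c t)^-1)%g, right_chart c g t).
  by rewrite mulgV.
rewrite E in dK *; rewrite -(derive_curve dp dK); apply: near_eq_derive.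
apply: filterS (gsmooth_near_dom sgc det) => s ds /=.
by rewrite /mulg_chart /right_chart /= !chartK// mulgA mulgVK.
Qed.

(** Right translation by [chart_inv phi u] followed by translation by its inverse is the identity
    near the unit; the chain rule does the rest. *)
Lemma logder_velocityK u v : (phi @` chart_dom phi) u ->
  logder_map (u, velocity_map (u, v)) = v.
Proof.
move=> du; have [dom_u pu] := chart_invP du.
have mul_e1 : mulg_chart (e1, u) = u by rewrite /mulg_chart /= chart_inv_e1// mul1g.
have dK1 : differentiable divg_chart (u, u).
  exact/smooth_at_differentiable/smooth_divg_chart.
have dK2 : differentiable mulg_chart (e1, u).
  exact/smooth_at_differentiable/smooth_mulg_chart.
have di : differentiable (id : vec -> vec) e1 by [].
have dc : differentiable (cst u : vec -> vec) e1 by [].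
have dp := differentiable_pair di dc.
have dK2' : differentiable (mulg_chart \o (fun w : vec => (w, u))) e1.
  exact: differentiable_comp.
rewrite /logder_map /velocity_map /= (derive_pairl _ dK2).
rewrite (derive_pairl _ dK1) -[X in 'D__ _ X]mul_e1.
have dK1' : differentiable (fun w => divg_chart (w, u))
    ((fun w => mulg_chart (w, u)) e1).
  rewrite mul_e1.
  have di' : differentiable (id : vec -> vec) u by [].
  have dc' : differentiable (cst u : vec -> vec) u by [].
  exact: (differentiable_comp (differentiable_pair di' dc')).
rewrite -[LHS](derive_comp v dK2' dK1') -[RHS](derive_id e1 v).
apply: near_eq_derive.
have : \forall w \near e1, chart_dom phi (chart_inv phi w * chart_inv phi u)%g.
  apply: (gsmooth_near_dom (f := fun w => chart_inv phi w * chart_inv phi u)%g).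
    apply: gsmooth_mul; last exact: gsmooth_cst.
    by apply: gsmooth_inv_at (e1_img phi_one) => //; exact: smooth_at_id.
  by rewrite chart_inv_e1// mul1g.
apply: filterS2 (near_e1_img phi_one) => w /chart_invP[dw pw] dwu /=.
by rewrite /divg_chart /mulg_chart /= chartK// mulgK pw.
Qed.

End LogDerivative.

(** * Jets and logarithmic derivatives *)

Section JetsLogDerivative.
Context {R : realType} {d : nat} {G : lieGroupType R d}.
Variable phi : chart R d G.
Hypotheses (phi_atlas : lie_atlas phi) (phi_one : chart_dom phi 1%g).
Implicit Types (c b : R -> G) (t : R).

Local Notation e1 := (phi 1%g).
Local Notation vec := 'rV[R]_d.
Local Notation delta := (right_log_derive phi).
Let frV : finite_coordinates vec := finite_coordinates_rV d.
Let frV2 : finite_coordinates (vec * vec)%type :=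
  finite_coordinates_prod frV frV.

Lemma same_jet_transport k c b (x y : R -> vec) (M : vec -> vec)
    (psi : chart R d G) :
  smooth_at x 0 -> smooth_at y 0 -> smooth_at M (x 0) ->
  {near (0 : R), (fun t => M (x t)) =1 fun t => psi (c t)} ->
  {near (0 : R), (fun t => M (y t)) =1 fun t => psi (b t)} ->
  same_jet k x y -> same_jet k (psi \o c) (psi \o b).
Proof.
move=> sx sy sM xc yb xy.
have h1 := near_eq_same_jet k xc; have h2 := near_eq_same_jet k yb.
apply: same_jet_trans (same_jet_sym h1) (same_jet_trans _ h2).
exact: (same_jet_comp frV sx sy sM xy).
Qed.

(** The right translate of [phi] to [c 0] need not lie in the atlas, but the changes of coordinates
    between it and the atlas charts are smooth, as multiplication is. *)
Lemma same_jet_right_chart k c b : gsmooth c 0 -> gsmooth b 0 -> c 0 = b 0 ->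
  (forall psi, lie_atlas psi -> chart_dom psi (c 0) ->
    same_jet k (psi \o c) (psi \o b)) <->
  same_jet k (right_chart phi c (c 0)) (right_chart phi b (c 0)).
Proof.
move=> sc sb cb; set g := c 0.
have gg (f : R -> G) : f 0 = g -> chart_dom phi (f 0 * g^-1)%g.
  by move=> ->; rewrite mulgV.
have gc := gg c erefl; have gb := gg b (esym cb).
have sgc := gsmooth_mulr g^-1%g sc; have sgb := gsmooth_mulr g^-1%g sb.
have su := smooth_right_chart phi_atlas sc gc.
have sv := smooth_right_chart phi_atlas sb gb.
have uc : {near (0 : R),
    (fun t => chart_inv phi (right_chart phi c g t) * g)%g =1 c}.
  apply: filterS (gsmooth_near_dom sgc gc) => t dt.
  by rewrite (chartK dt) mulgVK.
have vb : {near (0 : R),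
    (fun t => chart_inv phi (right_chart phi b g t) * g)%g =1 b}.
  apply: filterS (gsmooth_near_dom sgb gb) => t dt.
  by rewrite (chartK dt) mulgVK.
split=> [H|H psi apsi dpsi].
  have [psi apsi dpsi] := lie_atlas_cover g.
  have sx := sc.2 _ apsi dpsi.
  have dpsib : chart_dom psi (b 0) by rewrite -cb.
  have sy := sb.2 _ apsi dpsib.
  apply: (@same_jet_transport _ (fun t => c t * g^-1)%g (fun t => b t * g^-1)%g
    (psi \o c) (psi \o b) (fun w => phi (chart_inv psi w * g^-1)%g)) => //.
  - apply: (gsmooth_smooth phi_atlas); last by rewrite /= chartK.
    apply: gsmooth_mul; last exact: gsmooth_cst.
    apply: gsmooth_inv_at => //; first exact: smooth_at_id.
    by exists g.
  - by apply: filterS (gsmooth_near_dom sc dpsi) => t dt /=; rewrite (chartK dt).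
  - by apply: filterS (gsmooth_near_dom sb dpsib) => t dt /=; rewrite (chartK dt).
  - exact: H.
apply: (@same_jet_transport _ c b (right_chart phi c g) (right_chart phi b g)
   (fun w => psi (chart_inv phi w * g)%g)) => //.
- apply: (gsmooth_smooth apsi); last first.
    by rewrite /right_chart mulgV chart_inv_e1// mul1g.
  apply: gsmooth_mul; last exact: gsmooth_cst.
  apply: gsmooth_inv_at => //; first exact: smooth_at_id.
  by exists (g * g^-1)%g => //; exact: gc.
- by apply: filterS uc => t ->.
- by apply: filterS vb => t ->.
Qed.

Lemma near_right_chart c g : gsmooth c 0 -> chart_dom phi (c 0 * g^-1)%g ->
  \forall t \near (0 : R), gsmooth c t /\ chart_dom phi (c t * g^-1)%g.
Proof.
move=> sc dc; apply: filterS2 (gsmooth_near sc)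
  (gsmooth_near_dom (gsmooth_mulr g^-1%g sc) dc) => t st dt.
by split.
Qed.

Lemma right_chart_img c g t : chart_dom phi (c t * g^-1)%g ->
  (phi @` chart_dom phi) (right_chart phi c g t).
Proof. by move=> dt; exists (c t * g^-1)%g. Qed.

Lemma same_jet_logder k c b g : gsmooth c 0 -> gsmooth b 0 ->
  c 0 = b 0 -> chart_dom phi (c 0 * g^-1)%g ->
  same_jet k.+1 (right_chart phi c g) (right_chart phi b g) <->
  same_jet k (delta c) (delta b).
Proof.
move=> sc sb cb gc; have gb := gc; rewrite cb in gb.
have su := smooth_right_chart phi_atlas sc gc.
have sv := smooth_right_chart phi_atlas sb gb.
have u0 : right_chart phi c g 0 = right_chart phi b g 0.
  by rewrite /right_chart cb.
have nc : {near (0 : R), delta c =1 fun t =>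
    logder_map phi (right_chart phi c g t, derive1 (right_chart phi c g) t)}.
  apply: filterS (near_right_chart sc gc) => t [st dt].
  exact: right_log_derive_chart.
have nb : {near (0 : R), delta b =1 fun t =>
    logder_map phi (right_chart phi b g t, derive1 (right_chart phi b g) t)}.
  apply: filterS (near_right_chart sb gb) => t [st dt].
  exact: right_log_derive_chart.
have nc' : {near (0 : R), derive1 (right_chart phi c g) =1 fun t =>
    velocity_map phi (right_chart phi c g t, delta c t)}.
  apply: filterS (near_right_chart sc gc) => t [st dt].
  exact: right_chart_derive.
have nb' : {near (0 : R), derive1 (right_chart phi b g) =1 fun t =>
    velocity_map phi (right_chart phi b g t, delta b t)}.
  apply: filterS (near_right_chart sb gb) => t [st dt].
  exact: right_chart_derive.
have sdc := smooth_right_log_derive phi_atlas phi_one sc.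
have sdb := smooth_right_log_derive phi_atlas phi_one sb.
split=> [uv|cd].
  have [_ uv'] := (same_jetS _ _ _).1 uv.
  apply: same_jet_trans (near_eq_same_jet k nc) _.
  apply: same_jet_trans (same_jet_sym (near_eq_same_jet k nb)).
  have su' := smooth_at_derive1 su; have sv' := smooth_at_derive1 sv.
  apply: (same_jet_comp frV2 (F := logder_map phi)).
  - exact: (smooth_at_pair su su').
  - exact: (smooth_at_pair sv sv').
  - by apply: smooth_logder_map => //; exact: right_chart_img.
  - exact: (same_jet_pair su sv su' sv' (same_jet_leq (leqnSn k) uv) uv').
(* Bootstrap: agreement of the right charts to order [j], together with that of the logarithmic
   derivatives, gives agreement of the velocities to order [j], hence of the right charts to order
   [j.+1]. *)
suff H j : (j <= k.+1)%N ->
    same_jet j (right_chart phi c g) (right_chart phi b g).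
  exact: H.
elim: j => [_|j IH jk]; first exact: same_jet0P.
have uv := IH (ltnW jk); apply/same_jetS; split; first exact: u0.
apply: same_jet_trans (near_eq_same_jet j nc') _.
apply: same_jet_trans (same_jet_sym (near_eq_same_jet j nb')).
apply: (same_jet_comp frV2 (F := velocity_map phi)).
- exact: (smooth_at_pair su sdc).
- exact: (smooth_at_pair sv sdb).
- by apply: smooth_velocity_map => //; exact: right_chart_img.
- exact: (same_jet_pair su sv sdc sdb uv (same_jet_leq _ cd)).
Qed.

(* Picard iteration for u' = velocity_map (u, X), truncated at each step to a
   Taylor polynomial. *)
Fixpoint picard (X : R -> vec) (k n : nat) : R -> vec :=
  if n is m.+1 then
    taylor (fun i => if i is j.+1 then
      derive1n j (fun t => velocity_map phi (picard X k m t, X t)) 0 else e1) k.+2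
  else cst e1.

Lemma smooth_picard X k n t : smooth_at (picard X k n) t.
Proof. by case: n => [|n]; [exact: smooth_at_cst|exact: smooth_at_taylor]. Qed.

Lemma picard0 X k n : picard X k n 0 = e1.
Proof.
case: n => [//|n].
exact: (@taylor_derive1n _ _ (fun i => if i is j.+1 then
      derive1n j (fun t => velocity_map phi (picard X k n t, X t)) 0 else e1) k.+2 0).
Qed.

(** The truncation keeps [k.+2] coefficients, that is, order [k.+1], which is enough for the
    derivative to be right to order [k]. *)
Lemma picard_derive1 X k n : same_jet k (derive1 (picard X k n.+1))
  (fun t => velocity_map phi (picard X k n t, X t)).
Proof.
move=> i ik; rewrite -derive1Sn [picard _ _ _]/=.
by rewrite taylor_derive1n// ltnS.
Qed.

(** Each iteration gains one order: [velocity_map] preserves the order of agreement, and passing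
    from the derivative back to the curve raises it by one. *)
Lemma picardS X k n : (forall t, smooth_at X t) -> (n <= k.+1)%N ->
  same_jet n (picard X k n) (picard X k n.+1).
Proof.
move=> sX; elim: n => [_|n IH nk]; first by apply: same_jet0P; rewrite !picard0.
apply/same_jetS; split; first by rewrite !picard0.
have nk' : (n <= k)%N by [].
have h := same_jet_leq nk' (@picard_derive1 X k n).
have h' := same_jet_leq nk' (@picard_derive1 X k n.+1).
have sp m := smooth_picard X k m 0.
apply: same_jet_trans h (same_jet_trans _ (same_jet_sym h')).
apply: (same_jet_comp frV2 (F := velocity_map phi)).
- exact: (smooth_at_pair (sp n) (sX 0)).
- exact: (smooth_at_pair (sp n.+1) (sX 0)).
- by apply: smooth_velocity_map => //=; rewrite picard0; exact: e1_img.
- exact: (same_jet_pair (sp _) (sp _) (sX 0) (sX 0) (IH (ltnW nk))).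
Qed.

Lemma exists_curve_logder (g : G) (a : nat -> vec) k : exists c : R -> G,
  [/\ gsmooth c 0, c 0 = g &
     forall i, (i <= k)%N -> derive1n i (delta c) 0 = a i].
Proof.
pose X := taylor a k.+1; pose P := picard X k k.+1.
have sX t : smooth_at X t by exact: smooth_at_taylor.
have sP t : smooth_at P t by exact: smooth_picard.
have P0 : P 0 = e1 by exact: picard0.
pose c t := (chart_inv phi (P t) * g)%g.
have c0 : c 0 = g by rewrite /c P0 chart_inv_e1// mul1g.
have sc : gsmooth c 0.
  apply: gsmooth_mulr; apply: gsmooth_inv_at => //.
  by rewrite P0; exact: e1_img.
have gc : chart_dom phi (c 0 * g^-1)%g by rewrite c0 mulgV.
have uP : {near (0 : R), right_chart phi c g =1 P}.
  have : \forall t \near (0 : R), (phi @` chart_dom phi) (P t).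
    by apply: (smooth_at_continuous (sP 0)); rewrite P0; exact: near_e1_img.
  apply: filterS => t /chart_invP[_ pP].
  by rewrite /right_chart /c mulgK.
exists c; split=> // i ik; rewrite -(@taylor_derive1n _ _ a k.+1)//; move: i ik.
rewrite -/(same_jet k (delta c) X).
have nc : {near (0 : R), delta c =1 fun t => logder_map phi (P t, derive1 P t)}.
  apply: filterS3 (near_right_chart sc gc) uP (near_eq_derive1 uP).
  move=> t [st dt] Pt P't.
  by rewrite (right_log_derive_chart phi_atlas phi_one st dt) Pt P't.
(* Written this way, [X] differs from [delta c] only in the velocity fed to [logder_map]. *)
have nX : {near (0 : R), X =1 fun t =>
    logder_map phi (P t, velocity_map phi (P t, X t))}.
  have : \forall t \near (0 : R), (phi @` chart_dom phi) (P t).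
    by apply: (smooth_at_continuous (sP 0)); rewrite P0; exact: near_e1_img.
  by apply: filterS => t dt; rewrite logder_velocityK.
have dP0 : (phi @` chart_dom phi) (P 0) by rewrite P0; exact: e1_img.
have sP' := smooth_at_derive1 (sP 0).
have sPX : smooth_at (fun t => velocity_map phi (P t, X t)) 0.
  apply: (smooth_at_comp (f := velocity_map phi) frV2).
    exact: (smooth_at_pair (sP 0) (sX 0)).
  exact: smooth_velocity_map.
have hc := near_eq_same_jet k nc; have hX := near_eq_same_jet k nX.
apply: same_jet_trans hc (same_jet_trans _ (same_jet_sym hX)).
apply: (same_jet_comp frV2 (F := logder_map phi)).
- exact: (smooth_at_pair (sP 0) sP').
- exact: (smooth_at_pair (sP 0) sPX).
- exact: smooth_logder_map.
(* The iterates [k.+1] and [k.+2] agree to order [k.+1], and the derivative of the latter is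
   [velocity_map (P, X)] to order [k]; so [P] solves the equation to that order. *)
have /same_jetS[_ H] := picardS sX (leqnn k.+1).
have H' := same_jet_trans H (@picard_derive1 X k k.+1).
exact: (same_jet_pair (sP 0) (sP 0) sP' sPX (fun _ _ => erefl) H').
Qed.

End JetsLogDerivative.

(** * Higher derivatives of products and inverses *)

Lemma eq_in_foldl (T : eqType) S (f f' : S -> T -> S) z (s : seq T) :
  (forall i, i \in s -> forall v, f v i = f' v i) -> foldl f z s = foldl f' z s.
Proof.
elim: s z => //= i s IH z ff'; rewrite ff' ?mem_head// IH// => j js.
by apply: ff'; rewrite inE js orbT.
Qed.

Lemma eq_in_foldr (T : eqType) S (f f' : T -> S -> S) z (s : seq T) :
  (forall i, i \in s -> forall v, f i v = f' i v) -> foldr f z s = foldr f' z s.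
Proof.
elim: s => //= i s IH ff'; rewrite ff' ?mem_head// IH// => j js.
by apply: ff'; rewrite inE js orbT.
Qed.

Section IteratedDerivatives.
Context {R : realType} {V : normedModType R}.

Lemma near_derive1nD (f g : R -> V) (t : R) n : smooth_at f t -> smooth_at g t ->
  {near t, derive1n n (fun s => f s + g s) =1
    fun s => derive1n n f s + derive1n n g s}.
Proof.
move=> sf sg; elim: n => [|n IH]; first by near=> s.
have sfn := smooth_at_derive1n n sf; have sgn := smooth_at_derive1n n sg.
apply: filterS2 (near_eq_derive1 IH) (near_derive1D sfn sgn) => s e1 e2.
by rewrite derive1nS e1 e2.
Unshelve. all: by end_near. Qed.

Lemma smooth_at_scale_cst (a : R) (f : R -> V) t : smooth_at f t ->
  smooth_at (fun r => a *: f r) t /\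
  derive1 (fun r => a *: f r) t = a *: derive1 f t.
Proof.
move=> sf; split; first exact: (smooth_atZ (smooth_at_cst a t) sf).
rewrite !derive1E.
rewrite -[LHS]/('D_1 (a *: f) t) deriveZ//.
exact/diff_derivable/smooth_at_differentiable.
Qed.

Lemma derive1_sum_seq (I : eqType) (s : seq I) (f df : I -> R -> V) t :
  (forall i, i \in s -> smooth_at (f i) t /\ derive1 (f i) t = df i t) ->
  smooth_at (fun r => \sum_(i <- s) f i r) t /\
  derive1 (fun r => \sum_(i <- s) f i r) t = \sum_(i <- s) df i t.
Proof.
elim: s => [|i s IH] H.
  have -> : (fun r => \sum_(i <- [::]) f i r) = cst 0.
    by apply/funext => r; rewrite big_nil.
  by rewrite big_nil derive1_cst; split; first exact: smooth_at_cst.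
have -> : (fun r => \sum_(j <- i :: s) f j r) =
    fun r => f i r + \sum_(j <- s) f j r.
  by apply/funext => r; rewrite big_cons.
have [sf ef] := H i (mem_head _ _).
have [ss es] : smooth_at (fun r => \sum_(i <- s) f i r) t /\
    derive1 (fun r => \sum_(i <- s) f i r) t = \sum_(i <- s) df i t.
  by apply: IH => j js; apply: H; rewrite inE js orbT.
split; first exact: smooth_atD.
by rewrite (nbhs_singleton (near_derive1D sf ss)) big_cons ef es.
Qed.

(** The bridge between analysis and combinatorics: [comps 1] consists of [[:: 1]] alone, and each
    derivative performs one [comp_step]. [U] is a neighbourhood of each of its points, so the
    formula can be differentiated again. *)
Lemma derive1n_comps (U : set R) (F : seq nat -> R -> V) n t :
  (forall t, U t -> \forall s \near t, U s) ->
  (forall t s, U t -> s != [::] -> all (fun i => 0 < i)%N s ->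
    smooth_at (F s) t /\ derive1 (F s) t = step_sum (F ^~ t) s) ->
  U t -> derive1n n (F [:: 1%N]) t = \sum_(s <- comps n.+1) F s t.
Proof.
move=> nU dF; elim: n t => [|n IH] t Ut; first by rewrite /= big_seq1.
have e : {near t, derive1n n (F [:: 1%N]) =1
    fun r => \sum_(s <- comps n.+1) F s r}.
  by apply: filterS (nU t Ut) => r; exact: IH.
rewrite derive1nS (nbhs_singleton (near_eq_derive1 e)) sum_compsS.
apply: (derive1_sum_seq (df := fun s t => step_sum (F ^~ t) s) _).2.
move=> s /comps_composition/andP[ps /eqP ss]; apply: dF => //.
by apply: contra_eq_neq ss => ->.
Qed.

End IteratedDerivatives.

Section ProductAndInverse.
Context {R : realType} {d : nat} {G : lieGroupType R d}.
Variable phi : chart R d G.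
Hypotheses (phi_atlas : lie_atlas phi) (phi_one : chart_dom phi 1%g).
Implicit Types (c b : R -> G) (t : R).

Local Notation vec := 'rV[R]_d.
Local Notation delta := (right_log_derive phi).
(* Unification would otherwise unfold the bracket down to limits. *)
#[local] Opaque Ad ad.

(* The coordinate x_i of the paper, at time [t]; the indices start at 1. *)
Definition logder_coord c (t : R) (i : nat) : vec := derive1n i.-1 (delta c) t.

Lemma logder_coordE c t i : logder_coord c t i = derive1n i.-1 (delta c) t.
Proof. by []. Qed.

Lemma smooth_logder_coord c i t : gsmooth c t ->
  smooth_at (fun s => logder_coord c s i) t.
Proof.
move=> sc; apply: smooth_at_derive1n.
exact: (smooth_right_log_derive phi_atlas phi_one sc).
Qed.

(** By the truncated predecessor, index 0 denotes the same coordinate as index 1; hence the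
    positivity conditions on sequences. *)
Lemma derive_logder_coord c i t : (0 < i)%N ->
  derive1 (fun s => logder_coord c s i) t = logder_coord c t i.+1.
Proof. by case: i => [//|i] _; exact: erefl. Qed.

Lemma step_sumE (V : nmodType) (F : seq nat -> V) s :
  step_sum F s = F (1%N :: s) + \sum_(0 <= r < size s) F (incr_nth s r).
Proof. by rewrite /step_sum big_cons big_map /index_iota subn0. Qed.

Lemma ad_step_sum x (F : seq nat -> vec) s :
  step_sum (fun u => ad phi x (F u)) s = ad phi x (step_sum F s).
Proof.
have ad0 : ad phi x 0 = 0 by exact: ad0r.
have adD w z : ad phi x (w + z) = ad phi x w + ad phi x z by exact: adDr.
rewrite !step_sumE adD; congr (_ + _).
by elim/big_rec2: _ => [|i y z _ ->]; rewrite ?ad0 ?adD.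
Qed.

Lemma mul_term_rcons g (x y : nat -> vec) s m :
  mul_term phi g x y (rcons s m) =
  foldl (fun v i => ad phi (x i) v) (Ad phi g (y m)) s.
Proof. by rewrite /mul_term last_rcons size_rcons -cats1 take_size_cat. Qed.

Lemma mul_term_rcons2 g (x y : nat -> vec) s i m :
  mul_term phi g x y (rcons (rcons s i) m) =
  ad phi (x i) (mul_term phi g x y (rcons s m)).
Proof. by rewrite !mul_term_rcons foldl_rcons. Qed.

Lemma derive_mul_term c b s m t : gsmooth c t -> gsmooth b t ->
  all (fun i => 0 < i)%N s -> (0 < m)%N ->
  let F u t := mul_term phi (c t) (logder_coord c t) (logder_coord b t) u in
  smooth_at (F (rcons s m)) t /\
  derive1 (F (rcons s m)) t = step_sum (F ^~ t) (rcons s m).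
Proof.
move=> sc sb ps m0 F; elim/last_ind: s ps => [|s i IH] ps.
  have sY := smooth_logder_coord m sb.
  have EF : F (rcons [::] m) = fun s => Ad phi (c s) (logder_coord b s m).
    by [].
  rewrite EF; split; first exact: (smooth_Ad phi_atlas phi_one sc sY).
  rewrite (derive_Ad phi_atlas phi_one sc sY) (derive_logder_coord _ _ m0).
  (* The bracket with [delta c] is the term of [[:: 1; m]], and the derivative of the argument is
     that of [[:: m.+1]]. *)
  by rewrite step_sumE /= big_nat1 addrC.
have /andP[i0 ps'] : (0 < i)%N && all (fun i => 0 < i)%N s by rewrite -all_rcons.
have [sF eF] := IH ps'.
have EF : F (rcons (rcons s i) m) =
    fun t => ad phi (logder_coord c t i) (F (rcons s m) t).
  by apply/funext => r; rewrite /F mul_term_rcons2.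
have sX := smooth_logder_coord i sc.
rewrite EF; split; first exact: (smooth_ad phi_atlas phi_one sX sF).
rewrite (derive_ad phi_atlas phi_one sX sF) (derive_logder_coord _ _ i0) eF.
have Fi j u k : F (rcons (rcons u j) k) t =
    ad phi (logder_coord c t j) (F (rcons u k) t) by exact: mul_term_rcons2.
have E : step_sum (fun u => F (rcons (rcons u i) m) t) s =
    ad phi (logder_coord c t i) (step_sum (fun u => F (rcons u m) t) s).
  rewrite -ad_step_sum /step_sum; apply: eq_bigr => u _; exact: Fi.
rewrite step_sum_rcons step_sum_rcons step_sum_rcons E.
rewrite (Fi i.+1 s m) (Fi i s m.+1) (adDr phi_atlas phi_one).
have H (x y z : vec) : x + (y + z) = y + x + z by rewrite addrA [x + y]addrC.
exact: H.
Qed.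

Lemma inv_term_rcons g (x : nat -> vec) s m :
  inv_term phi g x (rcons s m) =
  Ad phi g^-1%g (foldr (fun i v => ad phi (x i) v) (x m) s).
Proof. by rewrite /inv_term last_rcons size_rcons -cats1 take_size_cat. Qed.

(** Only existing blocks grow here; the new first block will come from [Ad] of the inverse. The
    outermost bracket carries the first index, so the induction runs from the left. *)
Lemma derive_ad_iter c s m t : gsmooth c t ->
  all (fun i => 0 < i)%N s -> (0 < m)%N ->
  let E u k t :=
    foldr (fun i v => ad phi (logder_coord c t i) v) (logder_coord c t k) u in
  smooth_at (E s m) t /\
  derive1 (E s m) t = \sum_(0 <= r < size s) E (incr_nth s r) m t + E s m.+1 t.
Proof.
move=> sc ps m0 E; elim: s ps => [|i s IH] ps.
  rewrite big_geq// add0r; split; first exact: smooth_logder_coord.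
  exact: derive_logder_coord.
have /andP[i0 ps'] := ps; have [sE eE] := IH ps'.
have EE : E (i :: s) m = fun t => ad phi (logder_coord c t i) (E s m t) by [].
have sX := smooth_logder_coord i sc.
rewrite EE; split; first exact: (smooth_ad phi_atlas phi_one sX sE).
rewrite (derive_ad phi_atlas phi_one sX sE) (derive_logder_coord _ _ i0) eE.
rewrite (adDr phi_atlas phi_one) big_nat_recl//= -addrA; congr (_ + (_ + _)).
elim/big_rec2: _ => [|r y z _ <-]; first exact: ad0r.
exact: adDr.
Qed.

(** The sign is part of the term: the derivative of [Ad] of the inverse brings a factor -1 exactly
    when a first block is added, that is, when the length grows by one. *)
Lemma derive_inv_term c s m t : gsmooth c t ->
  all (fun i => 0 < i)%N s -> (0 < m)%N ->
  let F u t := (-1) ^+ size u *: inv_term phi (c t) (logder_coord c t) u in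
  smooth_at (F (rcons s m)) t /\
  derive1 (F (rcons s m)) t = step_sum (F ^~ t) (rcons s m).
Proof.
move=> sc ps m0 F.
pose E u k t :=
  foldr (fun i v => ad phi (logder_coord c t i) v) (logder_coord c t k) u.
have [sE eE] : smooth_at (E s m) t /\ derive1 (E s m) t =
    \sum_(0 <= r < size s) E (incr_nth s r) m t + E s m.+1 t.
  exact: derive_ad_iter.
have EF u k r :
    F (rcons u k) r = (-1) ^+ (size u).+1 *: Ad phi (c r)^-1%g (E u k r).
  by rewrite /F inv_term_rcons size_rcons.
have -> : F (rcons s m) =
    fun r => (-1) ^+ (size s).+1 *: Ad phi (c r)^-1%g (E s m r).
  by apply/funext => r; rewrite EF.
have sAE : smooth_at (fun r => Ad phi (c r)^-1%g (E s m r)) t.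
  exact: (smooth_Ad phi_atlas phi_one (gsmooth_invg sc) sE).
have [sZ ->] := smooth_at_scale_cst ((-1) ^+ (size s).+1) sAE.
split; first exact: sZ.
rewrite (derive_AdV phi_atlas phi_one sc sE) eE step_sum_rcons step_sumE.
pose L v := (-1) ^+ (size s).+1 *: Ad phi (c t)^-1%g v.
have LD v w : L (v + w) = L v + L w.
  by rewrite /L (AdD phi_atlas phi_one) scalerDr.
have LZ a v : L (a *: v) = a *: L v.
  by rewrite /L (AdZ phi_atlas phi_one) !scalerA mulrC.
have L0 : L 0 = 0 by rewrite -[X in L X](scale0r (0 : vec)) LZ scale0r.
have F1 : F (rcons (1%N :: s) m) t = - L (ad phi (delta c t) (E s m t)).
  by rewrite EF /L /= exprS mulN1r scaleNr.
have Fm : F (rcons s m.+1) t = L (E s m.+1 t) by rewrite EF.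
have Fr : \sum_(0 <= r < size s) F (rcons (incr_nth s r) m) t =
    L (\sum_(0 <= r < size s) E (incr_nth s r) m t).
  rewrite (big_morph L LD L0); apply: eq_big_nat => r /andP[_ rs].
  rewrite (EF (incr_nth s r) m t) size_incr_nth rs; exact: erefl.
rewrite F1 Fm Fr -/(L _) LD LD -[X in _ + L X = _]scaleN1r LZ scaleN1r.
have H (x y z : vec) : x + y - z = - z + x + y by rewrite addrC addrA.
exact: H.
Qed.

Lemma near_gsmooth2 c b t : gsmooth c t /\ gsmooth b t ->
  \forall s \near t, gsmooth c s /\ gsmooth b s.
Proof.
move=> [sc sb].
by apply: filterS2 (gsmooth_near sc) (gsmooth_near sb) => s; split.
Qed.

Lemma logder_coord_mul c b n : gsmooth c 0 -> gsmooth b 0 -> (0 < n)%N ->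
  logder_coord (fun s => c s * b s)%g 0 n = logder_coord c 0 n +
    \sum_(s <- comps n)
      mul_term phi (c 0) (logder_coord c 0) (logder_coord b 0) s.
Proof.
case: n => // n sc sb _; rewrite /logder_coord /=.
have sdc := smooth_right_log_derive phi_atlas phi_one sc.
have sdb := smooth_right_log_derive phi_atlas phi_one sb.
pose F u t := mul_term phi (c t) (logder_coord c t) (logder_coord b t) u.
have e : {near (0 : R), delta (fun s => c s * b s)%g =1
    fun s => delta c s + F [:: 1%N] s}.
  apply: filterS (near_gsmooth2 (conj sc sb)) => s [sc' sb'].
  exact: (right_log_deriveM phi_atlas phi_one sc' sb').
have sF : smooth_at (F [:: 1%N]) 0 := smooth_Ad phi_atlas phi_one sc sdb.
rewrite (nbhs_singleton (near_eq_derive1n n e)).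
rewrite (nbhs_singleton (near_derive1nD n sdc sF)); congr (_ + _).
apply: (@derive1n_comps _ _ [set t | gsmooth c t /\ gsmooth b t] F n 0) => //=.
  by move=> t; exact: near_gsmooth2.
move=> t s [sct sbt]; case/lastP: s => [//|s m] _.
rewrite all_rcons => /andP[m0 ps].
exact: (derive_mul_term sct sbt ps m0).
Qed.

Lemma logder_coord_inv c n : gsmooth c 0 -> (0 < n)%N ->
  logder_coord (fun s => (c s)^-1)%g 0 n =
    \sum_(s <- comps n)
      (-1) ^+ size s *: inv_term phi (c 0) (logder_coord c 0) s.
Proof.
case: n => // n sc _; rewrite /logder_coord /=.
pose F u t := (-1) ^+ size u *: inv_term phi (c t) (logder_coord c t) u.
have e : {near (0 : R), delta (fun s => (c s)^-1)%g =1 F [:: 1%N]}.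
  apply: filterS (gsmooth_near sc) => s sc'.
  rewrite (right_log_deriveV phi_atlas phi_one sc') /F expr1 scaleN1r.
  exact: erefl.
rewrite (nbhs_singleton (near_eq_derive1n n e)).
apply: (@derive1n_comps _ _ [set t | gsmooth c t] F n 0) => //=.
  by move=> t; exact: gsmooth_near.
move=> t s sct; case/lastP: s => [//|s m] _; rewrite all_rcons => /andP[m0 ps].
exact: (derive_inv_term sct ps m0).
Qed.

Lemma eq_mul_term g (x x' y y' : nat -> vec) s : s != [::] ->
  {in s, x =1 x'} -> {in s, y =1 y'} ->
  mul_term phi g x y s = mul_term phi g x' y' s.
Proof.
case/lastP: s => [/eqP[]//|s m] _ xx' yy'; rewrite !mul_term_rcons.
have -> : y m = y' m by apply: yy'; rewrite mem_rcons mem_head.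
apply: eq_in_foldl => i si v; rewrite [x i]xx'; first exact: erefl.
by rewrite mem_rcons inE si orbT.
Qed.

Lemma eq_inv_term g (x x' : nat -> vec) s : s != [::] -> {in s, x =1 x'} ->
  inv_term phi g x s = inv_term phi g x' s.
Proof.
case/lastP: s => [/eqP[]//|s m] _ xx'; rewrite !inv_term_rcons.
have -> : x m = x' m by apply: xx'; rewrite mem_rcons mem_head.
apply: (congr1 (Ad phi g^-1%g)); apply: eq_in_foldr => i si v.
by rewrite [x i]xx'// mem_rcons inE si orbT.
Qed.

End ProductAndInverse.

(** * The jet group *)

Section JetGroup.
Context {R : realType} {d : nat} {G : lieGroupType R d}.
Variable phi : chart R d G.
Hypotheses (phi_atlas : lie_atlas phi) (phi_one : chart_dom phi 1%g).
Variable k : nat.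
Hypothesis k_gt0 : (0 < k)%N.
Implicit Types (c b : R -> G).

Local Notation vec := 'rV[R]_d.
Local Notation delta := (right_log_derive phi).
(* Unification would otherwise unfold the coordinates down to limits. *)
#[local] Opaque Ad ad right_log_derive logder_coord.

(** [right_triv] read on an arbitrary curve instead of the chosen representative of a jet. *)
Definition curve_triv c : G * k.-tuple vec :=
  (c 0, [tuple derive1n i (delta c) 0 | i < k]).

Lemma right_trivE (a : jet G k) : right_triv phi a = curve_triv (repr a).
Proof. by []. Qed.

Lemma entry_curve_triv c n : (0 < n <= k)%N ->
  entry (curve_triv c).2 n = logder_coord phi c 0 n.
Proof.
case: n => // n nk.
by rewrite logder_coordE /entry /= (nth_mktuple _ _ (Ordinal nk)).
Qed.

Lemma curve_trivP c b : curve_triv c = curve_triv b <->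
  c 0 = b 0 /\ forall n, (0 < n <= k)%N ->
    logder_coord phi c 0 n = logder_coord phi b 0 n.
Proof.
split=> [e|[e0 e]].
  split=> [|n nk]; first exact: (congr1 fst e).
  by rewrite -(entry_curve_triv c nk) -(entry_curve_triv b nk) e.
apply: (f_equal2 pair e0); apply: eq_from_tnth => i.
have h := e i.+1 (ltn_ord i); rewrite 2!logder_coordE in h.
exact: (etrans (tnth_mktuple _ i) (etrans h (esym (tnth_mktuple _ i)))).
Qed.

Lemma gsmooth_curve (c : curve G) : gsmooth c 0.
Proof. by apply/smooth_near0P/asboolP; exact: curve_smooth. Qed.

(** A jet of order [k] of the curve corresponds to one of order [k.-1] of its logarithmic
    derivative; this shift uses [k_gt0]. *)
Lemma jet_eqE (c b : curve G) : jet_eq k c b <-> curve_triv c = curve_triv b.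
Proof.
have sc := gsmooth_curve c; have sb := gsmooth_curve b.
have e : c 0 = b 0 -> (same_jet k.-1 (delta c) (delta b) <->
  forall psi, lie_atlas psi -> chart_dom psi (c 0) ->
    same_jet k (psi \o c) (psi \o b)).
  move=> cb; rewrite (same_jet_right_chart phi_atlas phi_one k sc sb cb).
  rewrite -{2}(prednK k_gt0).
  have dc : chart_dom phi (c 0 * (c 0)^-1)%g by rewrite mulgV.
  exact: iff_sym (same_jet_logder phi_atlas phi_one k.-1 sc sb cb dc).
rewrite curve_trivP; split=> [/asboolP[cb h]|[cb h]].
  split=> [//|n /andP[n0 nk]]; rewrite !logder_coordE; apply: (e cb).2 h n.-1 _.
  by rewrite -ltnS !prednK.
apply/asboolP; split=> [//|psi apsi dpsi].
apply: ((e cb).1 _ psi apsi dpsi) => i ik.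
have := h i.+1; rewrite !logder_coordE; apply.
by rewrite /= -[k](prednK k_gt0).
Qed.

Lemma pi_repr (a : jet G k) : \pi_(jet G k) (repr a) = a.
Proof. exact: reprK. Qed.

Lemma eq_pi (c b : curve G) :
  jet_eq k c b <-> \pi_(jet G k) c = \pi_(jet G k) b.
Proof. by split=> /eqmodP. Qed.

Lemma right_triv_inj : injective (right_triv phi (k := k)).
Proof.
move=> a b; rewrite !right_trivE => /jet_eqE/eq_pi.
by rewrite !pi_repr.
Qed.

(** Smoothness keeps [insubd] away from its default, and [repr] may only replace the curve by one
    with the same jet. *)
Lemma right_triv_jet_of c :
  gsmooth c 0 -> right_triv phi (jet_of k c) = curve_triv c.
Proof.
move=> /smooth_near0P/asboolP sc; rewrite right_trivE /jet_of.
have e : val (insubd (cst_curve 1%g) c) = c by rewrite val_insubd sc.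
rewrite -[in RHS]e; apply/jet_eqE/eq_pi; exact: pi_repr.
Qed.

Lemma right_triv_bij : bijective (right_triv phi (k := k)).
Proof.
have : forall p : G * k.-tuple vec, exists a : jet G k, right_triv phi a = p.
  move=> [g x]; have [c [sc c0 cx]] :=
    exists_curve_logder phi_atlas phi_one g (fun i => nth 0 x i) k.
  exists (jet_of k c); rewrite right_triv_jet_of// /curve_triv c0; congr pair.
  apply: eq_from_tnth => i; rewrite tnth_mktuple cx ?(tnth_nth 0)//.
  exact/ltnW/ltn_ord.
(* A right inverse of an injective map is a two-sided inverse. *)
move=> /choice[f fK]; exists f => [a|p]; last exact: fK.
by apply: right_triv_inj; rewrite fK.
Qed.

(** The product formula involves only the coordinates of the factors of index at most [n], so the
    jet of a product does not depend on the representing curves. *)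
Lemma curve_triv_mul c c' b b' : gsmooth c 0 -> gsmooth c' 0 -> gsmooth b 0 ->
  gsmooth b' 0 -> curve_triv c = curve_triv c' -> curve_triv b = curve_triv b' ->
  curve_triv (fun t => c t * b t)%g = curve_triv (fun t => c' t * b' t)%g.
Proof.
move=> sc sc' sb sb' /curve_trivP[c0 ec] /curve_trivP[b0 eb].
apply/curve_trivP; split=> [|n /[dup] nk /andP[n0 nk']]; first by rewrite c0 b0.
apply: (etrans (logder_coord_mul phi_atlas phi_one sc sb n0)).
apply: (etrans _ (esym (logder_coord_mul phi_atlas phi_one sc' sb' n0))).
rewrite (ec n nk) c0; apply: congr1.
apply: eq_big_seq => s /comps_composition sn.
have h i : i \in s -> (0 < i <= k)%N.
  by move=> /(mem_composition sn)/andP[-> /leq_trans]; apply.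
apply: eq_mul_term => [|i /h|i /h]; [|exact: ec|exact: eb].
by apply: contraTneq sn => ->; case: n n0 {nk nk'}.
Qed.

(** The parts of a composition of [n] lie between 1 and [n], within the range where [entry] and
    [logder_coord] agree. *)
Lemma mul_formula (x y : k.-tuple vec) c b n : gsmooth c 0 -> gsmooth b 0 ->
  (curve_triv c).2 = x -> (curve_triv b).2 = y -> (0 < n <= k)%N ->
  logder_coord phi (fun t => c t * b t)%g 0 n = entry x n +
  \sum_(s <- comps n) mul_term phi (c 0) (entry x) (entry y) s.
Proof.
move=> sc sb <- <- /[dup] nk /andP[n0 nk'].
rewrite (logder_coord_mul phi_atlas phi_one sc sb n0) (entry_curve_triv c nk).
apply: congr1; apply: eq_big_seq => s /comps_composition sn.
have h i : i \in s -> (0 < i <= k)%N.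
  by move=> /(mem_composition sn)/andP[-> /leq_trans]; apply.
apply: eq_mul_term => [|i /h|i /h]; [|by move/entry_curve_triv ->..].
by apply: contraTneq sn => ->; case: n n0 {nk nk'}.
Qed.

Lemma inv_formula (x : k.-tuple vec) c n : gsmooth c 0 ->
  (curve_triv c).2 = x -> (0 < n <= k)%N ->
  logder_coord phi (fun t => (c t)^-1)%g 0 n =
  \sum_(s <- comps n) (-1) ^+ size s *: inv_term phi (c 0) (entry x) s.
Proof.
move=> sc <- /[dup] nk /andP[n0 nk'].
rewrite (logder_coord_inv phi_atlas phi_one sc n0).
apply: eq_big_seq => s /comps_composition sn; apply: (congr1 ( *:%R _)).
have h i : i \in s -> (0 < i <= k)%N.
  by move=> /(mem_composition sn)/andP[-> /leq_trans]; apply.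
apply: eq_inv_term => [|i /h]; [|by move/entry_curve_triv ->].
by apply: contraTneq sn => ->; case: n n0 {nk nk'}.
Qed.

Lemma jet_of_eq c b : gsmooth c 0 -> gsmooth b 0 ->
  jet_of k c = jet_of k b <-> curve_triv c = curve_triv b.
Proof.
move=> sc sb; have ec := right_triv_jet_of sc; have eb := right_triv_jet_of sb.
split=> e; last exact: right_triv_inj (etrans ec (etrans e (esym eb))).
exact: (etrans (esym ec) (etrans (congr1 (right_triv phi (k := k)) e) eb)).
Qed.

(** The pointwise inverse of a representing curve represents an inverse jet; any inverse agrees with
    it, as multiplying [ab] on the left by that curve shows. *)
Lemma jet_inverseP (a b : jet G k) :
  (jet_mul a b = jet_one G k /\ jet_mul b a = jet_one G k) <->
  right_triv phi b = curve_triv (fun t => (repr a t)^-1)%g.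
Proof.
have sa := gsmooth_curve (repr a); have sb := gsmooth_curve (repr b).
have si := gsmooth_invg sa; have s1 := gsmooth_cst (1%g : G) (0 : R).
have sab := gsmooth_mul sa sb; have sba := gsmooth_mul sb sa.
rewrite right_trivE; split=> [[ab _]|e].
  have {}ab := (jet_of_eq sab s1).1 ab.
  have := curve_triv_mul si si sab s1 erefl ab.
  have -> : (fun t => (repr a t)^-1 * (repr a t * repr b t))%g =
      repr b :> (R -> G).
    by apply/funext => t; rewrite mulKg.
  have -> : (fun t => (repr a t)^-1 * 1)%g =
      (fun t => (repr a t)^-1)%g :> (R -> G).
    by apply/funext => t; rewrite mulg1.
  exact.
split; [apply: (jet_of_eq sab s1).2|apply: (jet_of_eq sba s1).2].
  rewrite (curve_triv_mul sa sa sb si erefl e); congr curve_triv.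
  by apply/funext => t; rewrite mulgV.
rewrite (curve_triv_mul sb si sa sa e erefl); congr curve_triv.
by apply/funext => t; rewrite mulVg.
Qed.

End JetGroup.

Theorem theorem2p6 (R : realType) (d : nat) (G : lieGroupType R d)
    (phi : chart R d G) (phi_atlas : lie_atlas phi)
    (phi_one : chart_dom phi 1%g) (k : nat) (k_gt0 : (0 < k)%N) :
  bijective (right_triv phi (k := k)) /\
  (forall (g h : G) (x y : k.-tuple 'rV[R]_d) (a b : jet G k),
    right_triv phi a = (g, x) -> right_triv phi b = (h, y) ->
    exists2 z : k.-tuple 'rV[R]_d,
      right_triv phi (jet_mul a b) = ((g * h)%g, z) &
      forall n : nat, (0 < n <= k)%N ->
        entry z n = entry x n +
          \sum_(P : {set {set 'I_n}} | is_partition P)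
            mul_term phi g (entry x) (entry y) (block_sizes P) /\
        entry z n = entry x n +
          \sum_(1 <= l < n.+1)
            \sum_(s : l.-tuple 'I_n.+1 | is_composition n (map val s))
              mul_term phi g (entry x) (entry y) (map val s)
                *+ multN (map val s)) /\
  (forall (g : G) (x : k.-tuple 'rV[R]_d) (a b : jet G k),
    right_triv phi a = (g, x) ->
    ((jet_mul a b = jet_one G k /\ jet_mul b a = jet_one G k) <->
    exists2 w : k.-tuple 'rV[R]_d,
      right_triv phi b = (g^-1%g, w) &
      forall n : nat, (0 < n <= k)%N ->
        entry w n =
          \sum_(P : {set {set 'I_n}} | is_partition P)
            (-1) ^+ size (block_sizes P) *:
              inv_term phi g (entry x) (block_sizes P) /\
        entry w n =
          \sum_(1 <= l < n.+1)
            \sum_(s : l.-tuple 'I_n.+1 | is_composition n (map val s))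
              (-1) ^+ l *:
                (inv_term phi g (entry x) (map val s)
                  *+ multN (map val s)))).
Proof.
split; first exact: right_triv_bij.
split=> [g h x y a b|g x a b].
  rewrite !right_trivE => -[ga xa] [hb yb].
  have sa := gsmooth_curve (repr a); have sb := gsmooth_curve (repr b).
  exists (curve_triv phi k (fun t => repr a t * repr b t)%g).2.
    rewrite -ga -hb.
    exact: (right_triv_jet_of phi_atlas phi_one k_gt0 (gsmooth_mul sa sb)).
  move=> n nk; have /andP[n0 _] := nk; rewrite entry_curve_triv//.
  rewrite sum_partitions sum_compositions//.
  by rewrite (mul_formula phi_atlas phi_one sa sb xa yb nk) ga.
rewrite right_trivE => -[ga xa].
have sa := gsmooth_curve (repr a).
(* With the sign inside the summand, [sum_partitions] and [sum_compositions] apply to [T] directly;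
   on tuples of length [l] the sign is [(-1) ^+ l]. *)
pose T s := (-1) ^+ size s *: inv_term phi g (entry x) s.
have F n : (0 < n <= k)%N ->
    logder_coord phi (fun t => (repr a t)^-1)%g 0 n = \sum_(s <- comps n) T s.
  by move=> nk; rewrite (inv_formula phi_atlas phi_one sa xa nk) ga.
rewrite (jet_inverseP phi_atlas phi_one k_gt0); split=> [->|[w eb wF]].
  exists (curve_triv phi k (fun t => (repr a t)^-1)%g).2; first by rewrite -ga.
  move=> n nk; have /andP[n0 _] := nk.
  rewrite entry_curve_triv// F//; split.
    exact/esym/(sum_partitions n T).
  rewrite -(sum_compositions T n0).
  apply: eq_big_nat => l _; apply: eq_bigr => s _.
  by rewrite /T size_map size_tuple scalerMnr.
(* Position [i] of the tuple is the coordinate of index [i.+1], so the formula determines every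
   entry of [w]. *)
rewrite eb /curve_triv ga; congr pair; apply: eq_from_tnth => -[i ik].
have := wF i.+1 ik.
rewrite (sum_partitions i.+1 T).
rewrite -F// => -[e _]; rewrite tnth_mktuple (tnth_nth 0).
exact: e.
Qed.
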